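(* Let $d\ge2$ be an integer and let $\lambda\in\mathbb{C}$. For every nonzero function $u:\mathbb{Z}^d\to\mathbb{C}$ with $A_du=\lambda u$ one has $$\dim_{\mathbb{C}}\overline{\operatorname{supp}(u)}^{\,\mathrm{Zar}}\ \ge\ \left\lceil \frac d2\right\rceil .$$ Moreover, if $\lambda\ne0$, then $$\dim_{\mathbb{C}}\overline{\operatorname{supp}(u)}^{\,\mathrm{Zar}}\ \ge\ \left\lfloor \frac d2\right\rfloor+1 .$$ Both bounds are optimal: for every $d\ge2$ there exist $\lambda\in\mathbb{C}$ and a nonzero $u$ with $A_du=\lambda u$ attaining equality in the first bound, and for every $d\ge2$ there exist $\lambda\neq 0$ and a nonzero $u$ with $A_du=\lambda u$ attaining equality in the second bound. In particular, the second bound is attained in every dimension $d\ge 2$ by a harmonic function, i.e. by a nonzero $u$ with $A_du=2d\,u$.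
   Context: Let $e_1,\dots,e_d$ be the standard basis of $\mathbb{Z}^d$ and $(A_du)(x)=\sum_{i=1}^d\bigl(u(x+e_i)+u(x-e_i)\bigr)$ for $u:\mathbb{Z}^d\to\mathbb{C}$. Let $\operatorname{supp}(u)=\{x\in\mathbb{Z}^d:u(x)\neq0\}$, and let $\overline{S}^{\,\mathrm{Zar}}$ denote the Zariski closure in $\mathbb{C}^d$ of a set $S\subset\mathbb{Z}^d\subset\mathbb{C}^d$. *)

(* Defs.v *)
From HB Require Import structures.
From mathcomp Require Import all_boot all_order all_algebra.
From mathcomp Require Import classical_sets reals.
From mathcomp Require Import complex mpoly.

Set Implicit Arguments.
Unset Strict Implicit.
Unset Printing Implicit Defensive.

Import Order.TTheory GRing.Theory Num.Theory.

Local Open Scope classical_set_scope.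
Local Open Scope ring_scope.

Section Lattice.
Variables (R : realType) (d : nat).

Definition adjacency (u : 'rV[int]_d -> R[i]) (x : 'rV[int]_d) : R[i] :=
  \sum_(i < d) (u (x + delta_mx 0 i) + u (x - delta_mx 0 i)).

(* An eigenvector need not be nonzero here: nonvanishing is a separate
   hypothesis. *)
Definition eigenfunction (lambda : R[i]) (u : 'rV[int]_d -> R[i]) : Prop :=
  forall x, adjacency u x = lambda * u x.

Definition nonzero (u : 'rV[int]_d -> R[i]) : Prop := exists x, u x != 0.

Definition supp (u : 'rV[int]_d -> R[i]) : set 'rV[int]_d :=
  [set x | u x != 0].

Definition lattice_embed (x : 'rV[int]_d) : 'rV[R[i]]_d := map_mx intr x.

End Lattice.

Section Zariski.
Variables (R : realType) (d : nat).
Implicit Types (S V Z : set 'rV[R[i]]_d).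

Definition zero_locus (I : set {mpoly R[i][d]}) : set 'rV[R[i]]_d :=
  [set v | forall p, I p -> p.@[v ord0] = 0].

Definition vanishing_ideal S : set {mpoly R[i][d]} :=
  [set p | forall v, S v -> p.@[v ord0] = 0].

Definition zariski_closed Z : Prop := exists I, Z = zero_locus I.

Definition zariski_closure S : set 'rV[R[i]]_d :=
  zero_locus (vanishing_ideal S).

Definition zariski_irreducible Z : Prop :=
  Z !=set0 /\
  forall A B, zariski_closed A -> zariski_closed B ->
    Z `<=` A `|` B -> Z `<=` A \/ Z `<=` B.

(* Z 0 < Z 1 < ... < Z n: there are n strict inclusions and n.+1 sets. *)
Definition irreducible_chain V (n : nat) : Prop :=
  exists Z : nat -> set 'rV[R[i]]_d,
    (forall i, (i <= n)%N ->
       [/\ zariski_closed (Z i), zariski_irreducible (Z i) & Z i `<=` V]) /\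
    (forall i, (i < n)%N -> Z i `<` Z i.+1).

(* "dim V = n" for a Zariski closed V, where dim is the Krull dimension of V
   with the Zariski topology. The empty set has no dimension in this sense. *)
Definition has_dim V (n : nat) : Prop :=
  irreducible_chain V n /\ forall m, irreducible_chain V m -> (m <= n)%N.

Definition dim_ge V (k : nat) : Prop := exists2 n, has_dim V n & (k <= n)%N.

End Zariski.

Definition supp_closure (R : realType) (d : nat) (u : 'rV[int]_d -> R[i]) :
    set 'rV[R[i]]_d :=
  zariski_closure (@lattice_embed R d @` supp u).

(* Main.v *)
Require Import Defs.
From HB Require Import structures.
From mathcomp Require Import all_boot all_order all_algebra.
From mathcomp Require Import boolp classical_sets functions reals.
From mathcomp Require Import complex mpoly.
From mathcomp Require Import zify ring.

Set Implicit Arguments.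
Unset Strict Implicit.
Unset Printing Implicit Defensive.

Import Order.TTheory GRing.Theory Num.Theory.

Local Open Scope classical_set_scope.
Local Open Scope ring_scope.

(** Why the theorem holds.

    Lower bounds. Let [V] be the closure of the support of [u] and let [V0] be an
    irreducible component of [V] of maximal dimension. Let [L] be the space of
    directions of [V0], that is, of the vectors [w] such that [V0] contains with
    each point the line through it in the direction [w]. As [V0] contains a
    translate of [L], in which the flags of affine subspaces are chains of
    irreducible sets, it suffices to bound the dimension of [L] from below.

    For a lattice point [b], let [u_b] be the restriction of [u] to [V0 + b]. It
    depends only on the class of [b] modulo [L]; conversely [V0 + b] determines
    this class, because a lattice vector which stabilizes the closed set [V0] is a
    direction of [V0] ([closed_direction]). Cutting the equation
    along [V0 + b] shows that the family [u_b] satisfies it degree by degree, the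
    degree being the class of [b]. Modulo the functions whose support is too
    small to be dense in a translate of [V0], only the finitely many [V0 + b]
    which are components of [V] matter, so [u] becomes a nonzero Laurent
    polynomial in the degrees, killed by the Laurent polynomial
    [sum_i (z_i + z_i^-1) - lambda]. By McCoy's theorem (lemma [mccoy]) all the
    homogeneous parts of the latter then kill a common nonzero element. A part
    consisting of one monomial is invertible, so no exponent [e_i], [- e_i], and
    also not [0] if [lambda <> 0], is alone in its class modulo [L]
    ([support_directions]). Thus the nonzero classes of the [e_i] up to sign have
    at least two members each, there are at most [d / 2] of them, and at most
    [(d - 1) / 2] when [lambda <> 0], since then some [e_i] lies in [L]. These
    classes span the quotient by [L] ([rank_of_linked]).

    Chains of irreducible sets. A chain of length [n] gives [n] polynomials which
    are algebraically independent on its top: choose each one to vanish on a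
    member of the chain and not on the next one ([chain_independent]). Comparing
    the number of their monomials with the dimension of the spaces of polynomials
    of bounded degree shows that an affine subspace of dimension [r] has no chain
    longer than [r] ([chain_le_rank]). Finiteness of the number of components is
    Hilbert's basis theorem ([zariski_closed_dcc]).

    Optimality. On the lattice points with [x_i = x_(k+i)] for [i < k] take a
    character with value [-1] on the first and [1] on the second coordinate
    vector of each pair. Outside its support the neighbours cancel in pairs; on
    it only the [m] unpaired coordinates contribute, and the eigenvalue
    [sum_j (w_j + w_j^-1)] is arbitrary as soon as [m > 0]. The closure of the
    support is the linear space with the same equations, of dimension [k + m]
    where [d = 2 k + m]. *)

(** * Zariski closed sets *)

Section ZariskiTopology.
Variables (R : realType) (d : nat).
Local Notation C := R[i].
Implicit Types (S Y Z : set 'rV[C]_d) (p q : {mpoly C[d]}) (a b v : 'rV[C]_d).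

Lemma sub_zariski_closure S : S `<=` zariski_closure S.
Proof. by move=> v Sv p; apply. Qed.

Lemma zariski_closure_closed S : zariski_closed (zariski_closure S).
Proof. by exists (vanishing_ideal S). Qed.

Lemma zariski_closure_min S Z : zariski_closed Z -> S `<=` Z ->
  zariski_closure S `<=` Z.
Proof. by move=> [I ->] SZ v Sv p Ip; apply: Sv => w /SZ; apply. Qed.

Lemma zariski_closureS S Y : S `<=` Y -> zariski_closure S `<=` zariski_closure Y.
Proof.
move=> SY; apply: zariski_closure_min (@zariski_closure_closed Y) _.
exact: subset_trans SY (@sub_zariski_closure Y).
Qed.

Lemma zariski_closed_separated Y Z : zariski_closed Z -> ~ Y `<=` Z ->
  exists2 p, vanishing_ideal Z p & exists2 v, Y v & p.@[v ord0] != 0.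
Proof.
move=> [I ->] /existsNP[v /not_implyP[Yv /existsNP[p /not_implyP[Ip pv]]]].
by exists p; [move=> w; apply | exists v => //; apply/eqP].
Qed.

Lemma zariski_closedU Y Z :
  zariski_closed Y -> zariski_closed Z -> zariski_closed (Y `|` Z).
Proof.
move=> Yc Zc; exists (vanishing_ideal (Y `|` Z)); apply/seteqP; split.
  exact: sub_zariski_closure.
move=> v Hv; apply: contrapT => /not_orP[nY nZ].
have [|p Yp [w wv pw]] := @zariski_closed_separated [set v] Y Yc; first by move=> /(_ v erefl).
have [|q Zq [w' wv' qw]] := @zariski_closed_separated [set v] Z Zc; first by move=> /(_ v erefl).
rewrite /= in wv wv'; subst w w'.
have /Hv : vanishing_ideal (Y `|` Z) (p * q).
  by move=> x [/Yp|/Zq] H; rewrite mevalM H (mul0r, mulr0).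
by apply/eqP; rewrite mevalM mulf_neq0.
Qed.

Lemma zariski_closedI Y Z :
  zariski_closed Y -> zariski_closed Z -> zariski_closed (Y `&` Z).
Proof.
move=> [I ->] [J ->]; exists (I `|` J); apply/seteqP; split.
  by move=> v [Iv Jv] p [/Iv|/Jv].
by move=> v H; split=> p Ip; apply: H; [left|right].
Qed.

Lemma zariski_closure_setU S Y :
  zariski_closure (S `|` Y) `<=` zariski_closure S `|` zariski_closure Y.
Proof.
apply: zariski_closure_min.
  by apply: zariski_closedU; apply: zariski_closure_closed.
by move=> v [/sub_zariski_closure|/sub_zariski_closure]; [left|right].
Qed.

(** The coordinate ring of an irreducible set is an integral domain; the next
    lemma is the converse. *)
Lemma irreducible_vanishingM Z p q : zariski_irreducible Z ->
  vanishing_ideal Z (p * q) -> vanishing_ideal Z p \/ vanishing_ideal Z q.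
Proof.
move=> [_ Zirr] pq.
have [||v Zv|H|H] := Zirr (zero_locus [set p]) (zero_locus [set q]).
- by exists [set p].
- by exists [set q].
- have := pq v Zv; rewrite mevalM => /eqP; rewrite mulf_eq0 => /orP[]/eqP H.
    by left=> _ ->.
  by right=> _ ->.
- by left=> v /H; apply.
- by right=> v /H; apply.
Qed.

Lemma zariski_irreducibleP Z : Z !=set0 ->
  (forall p q, vanishing_ideal Z (p * q) ->
     vanishing_ideal Z p \/ vanishing_ideal Z q) -> zariski_irreducible Z.
Proof.
move=> Z0 H; split=> // A B Ac Bc ZAB.
apply: contrapT => /not_orP[nA nB].
have [p Ap [v Zv pv]] := zariski_closed_separated Ac nA.
have [q Bq [w Zw qw]] := zariski_closed_separated Bc nB.
have [|/(_ v Zv)/eqP|/(_ w Zw)/eqP] := H p q.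
- by move=> x /ZAB[/Ap|/Bq] e; rewrite mevalM e (mul0r, mulr0).
- by rewrite (negPf pv).
- by rewrite (negPf qw).
Qed.

Definition translate a Z : set 'rV[C]_d := [set v | Z (v - a)].

Definition shift_mpoly a p : {mpoly C[d]} :=
  p \mPo [tuple 'X_i + (a ord0 i)%:MP | i < d].

Lemma shift_mpolyE a p v : (shift_mpoly a p).@[v ord0] = p.@[(v + a) ord0].
Proof.
rewrite comp_mpoly_meval; apply: meval_eq => i.
by rewrite tnth_mktuple mevalD mevalXU mevalC mxE.
Qed.

Lemma shift_mpolyM a p q : shift_mpoly a (p * q) = shift_mpoly a p * shift_mpoly a q.
Proof. exact: rmorphM. Qed.

Lemma translate0 Z : translate 0 Z = Z.
Proof. by apply/seteqP; split=> v; rewrite /translate /= subr0. Qed.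

Lemma translateD a b Z : translate a (translate b Z) = translate (a + b) Z.
Proof. by apply/seteqP; split=> v; rewrite /translate /= opprD addrA. Qed.

Lemma translateS a Y Z : Y `<=` Z -> translate a Y `<=` translate a Z.
Proof. by move=> YZ v /YZ. Qed.

Lemma translate_proper a Y Z : Y `<` Z -> translate a Y `<` translate a Z.
Proof.
move=> [YZ nZY]; split; first exact: translateS.
by move=> /(translateS (a := - a)); rewrite !translateD addNr !translate0.
Qed.

Lemma zariski_closed_translate a Z : zariski_closed Z -> zariski_closed (translate a Z).
Proof.
move=> [I ->]; exists (shift_mpoly (- a) @` I); apply/seteqP; split.
  by move=> v Hv _ [p Ip <-]; rewrite shift_mpolyE; apply: Hv.
by move=> v Hv p Ip; rewrite -shift_mpolyE; apply: Hv; exists p.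
Qed.

Lemma vanishing_ideal_translate a Z p :
  vanishing_ideal (translate a Z) p <-> vanishing_ideal Z (shift_mpoly a p).
Proof.
split=> H v Zv.
  by rewrite shift_mpolyE; apply: H; rewrite /translate /= addrK.
by have := H _ Zv; rewrite shift_mpolyE subrK.
Qed.

Lemma zariski_irreducible_translate a Z :
  zariski_irreducible Z -> zariski_irreducible (translate a Z).
Proof.
move=> Zirr; apply: zariski_irreducibleP => [|p q].
  by case: Zirr => -[v Zv] _; exists (v + a); rewrite /translate /= addrK.
rewrite !vanishing_ideal_translate shift_mpolyM.
exact: irreducible_vanishingM.
Qed.

Lemma zariski_closure_translate a S :
  zariski_closure (translate a S) = translate a (zariski_closure S).
Proof.
suff sub b X : zariski_closure (translate b X) `<=` translate b (zariski_closure X).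
  apply/seteqP; split; first exact: sub.
  have := @translateS a _ _ (sub (- a) (translate a S)).
  by rewrite !translateD subrr addNr !translate0.
apply: zariski_closure_min; last by apply: translateS; apply: sub_zariski_closure.
exact/zariski_closed_translate/zariski_closure_closed.
Qed.

(** * Restriction of polynomials to lines *)

Definition line_poly a b p : {poly C} :=
  mmap polyC (fun i => (a ord0 i)%:P + (b ord0 i) *: 'X) p.

Lemma line_polyE a b p t : (line_poly a b p).[t] = p.@[(a + t *: b) ord0].
Proof.
rewrite /line_poly /mmap mevalE horner_sum; apply: eq_bigr => m _.
rewrite hornerM hornerC /mmap1 horner_prod; congr (_ * _); apply: eq_bigr => i _.
by rewrite horner_exp hornerD hornerC hornerZ hornerX !mxE [t * _]mulrC.
Qed.

Lemma poly_nat_roots (p : {poly C}) : (forall k : nat, p.[k%:R] = 0) -> p = 0.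
Proof.
move=> H; apply/eqP/negPn/negP => p0.
have Hall : all (root p) [seq k%:R | k <- iota 0 (size p)].
  by apply/allP => _ /mapP[k _ ->]; apply/rootP.
have Huniq : uniq [seq k%:R : C | k <- iota 0 (size p)].
  by rewrite map_inj_uniq ?iota_uniq // => m k /eqP; rewrite eqr_nat => /eqP.
by have := max_poly_roots p0 Hall Huniq; rewrite size_map size_iota ltnn.
Qed.

(** The equations of [Z] restrict to the line as polynomials in one variable
    with infinitely many roots. *)
Lemma line_in_closed Z a b : zariski_closed Z ->
  (forall k : nat, Z (a + k%:R *: b)) -> forall t : C, Z (a + t *: b).
Proof.
move=> [I ->] H t p Ip.
rewrite -line_polyE [line_poly a b p]poly_nat_roots ?horner0 // => k.
by rewrite line_polyE; apply: H.
Qed.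

(** Given two proper closed subsets, take a point of [Z] missed by the first one
    and a point of [Z] missed by the second one. Each of the two subsets meets
    the line through these points in finitely many points, hence they do not
    cover it. *)
Lemma irreducible_of_lines Z : Z !=set0 ->
  (forall v w (t : C), Z v -> Z w -> Z (v + t *: (w - v))) -> zariski_irreducible Z.
Proof.
move=> Z0 Zlines; apply: zariski_irreducibleP => // p q pq.
apply: contrapT => /not_orP[/existsNP[v /not_implyP[Zv pv]]].
move=> /existsNP[w /not_implyP[Zw qw]].
have : line_poly v (w - v) p * line_poly v (w - v) q != 0.
  apply: mulf_neq0; apply/eqP.
    by move=> /(congr1 (fun r => r.[0])); rewrite line_polyE horner0 scale0r addr0.
  by move=> /(congr1 (fun r => r.[1])); rewrite line_polyE horner0 scale1r addrC subrK.
apply/negP/negPn/eqP/poly_nat_roots => k.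
by rewrite hornerM !line_polyE -mevalM; apply/pq/Zlines.
Qed.

End ZariskiTopology.

(** * Noetherianity and irreducible components *)

(** Take at each step an index where [f] is minimal among the remaining ones. *)
Lemma nondecreasing_subsequence (f : nat -> nat) : exists2 phi : nat -> nat,
  {homo phi : i j / (i < j)%N} & {homo f \o phi : i j / (i <= j)%N}.
Proof.
have /choice[g gP] N : exists n, (N <= n)%N /\ forall m, (N <= m)%N -> (f n <= f m)%N.
  have [|v /asboolP[n [Nn <-]] vmin] :=
    @ex_minnP (fun v => `[< exists n, (N <= n)%N /\ f n = v >]).
    by exists (f N); apply/asboolP; exists N.
  by exists n; split=> // m Nm; apply: vmin; apply/asboolP; exists m.
pose phi := fix phi k := if k is k'.+1 then g (phi k').+1 else g 0.
exists phi; first by apply: (homo_ltn ltn_trans) => k; have [] := gP (phi k).+1.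
apply: (homo_leq leqnn leq_trans) => k /=.
case: k => [|k] /=; first by have [_] := gP 0; apply.
have [le_gk min_gk] := gP (phi k).+1; apply: min_gk.
have [le_g _] := gP (g (phi k).+1).+1.
exact: leq_trans le_gk (ltnW le_g).
Qed.

(** Dickson's lemma: pass to a subsequence along which the first exponent is
    nondecreasing, then to a subsequence of it for the second one, and so on. *)
Lemma dickson n (m : nat -> 'X_{1..n}) :
  exists i j, (i < j)%N /\ (m i <= m j)%MM.
Proof.
suff H k : exists2 phi : nat -> nat, {homo phi : i j / (i < j)%N} &
    forall c : 'I_n, (c < k)%N -> {homo (fun i => m (phi i) c) : i j / (i <= j)%N}.
  have [phi phi_inc mphi] := H n; exists (phi 0), (phi 1); split; first exact: phi_inc.
  by apply/mnm_lepP => c; apply: mphi.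
elim: k => [|k [phi phi_inc mphi]]; first by exists id.
have [kn|nk] := ltnP k n; last first.
  by exists phi => // c _; apply: mphi; apply: leq_trans nk.
have [psi psi_inc mpsi] := nondecreasing_subsequence (fun i => m (phi i) (Ordinal kn)).
exists (phi \o psi) => [i j ij|c]; first exact/phi_inc/psi_inc.
rewrite ltnS leq_eqVlt => /orP[/eqP ck|ck] i j ij /=.
  have -> : c = Ordinal kn by apply: val_inj.
  exact: mpsi.
apply: mphi => //; move: ij.
by rewrite leq_eqVlt => /orP[/eqP->|/psi_inc/ltnW].
Qed.

Section Noetherian.
Variables (R : realType) (d : nat).
Local Notation C := R[i].
Implicit Types (S Y Z : set 'rV[C]_d) (p q : {mpoly C[d]}).

(** Hilbert's basis theorem, through leading monomials: in a strictly
    decreasing sequence of closed sets, take at each step an equation gained at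
    that step whose leading monomial is minimal; Dickson's lemma provides a
    pair of these equations in which the earlier one reduces the later one. *)
Lemma zariski_closed_dcc (Z : nat -> set 'rV[C]_d) :
  (forall i, zariski_closed (Z i)) -> ~ (forall i, Z i.+1 `<` Z i).
Proof.
move=> Zc Zdec; pose I i := vanishing_ideal (Z i).
have Isub i j : (i <= j)%N -> I i `<=` I j.
  move=> ij p; suff ZS : Z j `<=` Z i by move=> Ip v /ZS /Ip.
  elim: j ij => [|j IH]; first by rewrite leqn0 => /eqP->.
  rewrite leq_eqVlt => /orP[/eqP-> //|ij].
  exact: subset_trans (proj1 (Zdec j)) (IH ij).
have /choice[p pP] i : exists p, [/\ I i.+1 p, ~ I i p &
    forall q, I i.+1 q -> ~ I i q -> ~ (mlead q < mlead p)%O].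
  have [q Iq [v Zv qv]] := zariski_closed_separated (Zc i.+1) (proj2 (Zdec i)).
  have nIq : ~ I i q by move=> /(_ v Zv)/eqP; apply/negP.
  move: {2}(mlead q) (erefl (mlead q)) Iq nIq => m.
  elim/(well_founded_induction (@ltom_wf d)) : m q {v Zv qv} => m IH q qm Iq nIq.
  have [[r [Ir nIr lt_rq]]|nr] := pselect (exists r, [/\ I i.+1 r, ~ I i r &
      (mlead r < mlead q)%O]).
    by apply: (IH _ _ r erefl) => //; rewrite -qm.
  exists q; split=> // r Ir nIr lt_rq; apply: nr; by exists r.
have [i [j [ij le_ij]]] := dickson (fun k => mlead (p k)).
have [Ii nIi _] := pP i; have [Ij nIj minj] := pP j.
have pi0 : p i != 0 by apply/eqP => E; apply: nIi; rewrite E => v _; rewrite meval0.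
pose t := (mleadc (p j) / mleadc (p i)) *: 'X_[mlead (p j) - mlead (p i)] * p i.
have It k : (i < k)%N -> I k t.
  by move=> /Isub /(_ _ Ii) H v Zv; rewrite mevalM H ?mulr0.
have lt : (mlead t <= mlead (p j))%O.
  rewrite /t -scalerAl; apply: le_trans (mleadZ_le _ _) _.
  by rewrite mleadM ?mleadXm ?submK // -msupp_eq0 msuppX.
have ct : t@_(mlead (p j)) = mleadc (p j).
  rewrite /t -scalerAl mcoeffZ -[X in _ * (_)@_X](submK le_ij) mulrC /=.
  by rewrite [_ * p i]mulrC mcoeffMX mulrC divfK // mleadc_eq0.
have nIq : ~ I j (p j - t).
  by move=> H; apply: nIj => v Zv; have := H v Zv; rewrite mevalB (It j ij v Zv) subr0.
apply: (minj (p j - t)) => //.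
  by move=> v Zv; rewrite mevalB (Ij v Zv) (It j.+1 (ltnW ij) v Zv) subr0.
rewrite lt_neqAle; apply/andP; split.
  apply/eqP => E; apply: nIq; suff -> : p j - t = 0 by move=> v _; rewrite meval0.
  by apply/eqP; rewrite -mleadc_eq0 E mcoeffB ct subrr.
by apply: le_trans (mleadB_le _ _) _; rewrite leUx lexx.
Qed.

Lemma zariski_closed_minimal (P : set 'rV[C]_d -> Prop) Z :
  zariski_closed Z -> P Z ->
  exists Y, [/\ zariski_closed Y, P Y &
    forall X, zariski_closed X -> X `<` Y -> ~ P X].
Proof.
move=> Zc PZ; apply: contrapT => nmin.
have /choice[f fP] (Y : {Y | zariski_closed Y /\ P Y}) :
    exists X : {Y | zariski_closed Y /\ P Y}, sval X `<` sval Y.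
  case: Y => Y [Yc PY] /=; apply: contrapT => nX; apply: nmin; exists Y; split=> //.
  by move=> X Xc XY PX; apply: nX; exists (exist _ X (conj Xc PX)).
pose W := fix W k := if k is k'.+1 then f (W k') else exist _ Z (conj Zc PZ).
apply: (@zariski_closed_dcc (fun k => sval (W k))) => k; last exact: fP.
by case: (svalP (W k)).
Qed.

Definition finite_irreducible_cover Z (s : seq (set 'rV[C]_d)) : Prop :=
  (forall Y, List.In Y s -> [/\ zariski_closed Y, zariski_irreducible Y & Y `<=` Z]) /\
  (forall v, Z v -> exists2 Y, List.In Y s & Y v).

(** A minimal closed set without such a cover would be reducible, hence the union
    of two smaller closed sets, which have one. *)
Lemma irreducible_decomposition Z : zariski_closed Z ->
  exists s, finite_irreducible_cover Z s.
Proof.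
move=> Zc; apply: contrapT => nZ.
have [Y [Yc nY Ymin]] := @zariski_closed_minimal
  (fun Z => ~ exists s, finite_irreducible_cover Z s) Z Zc nZ.
have {}Ymin X : zariski_closed X -> X `<=` Y -> ~ Y `<=` X ->
    exists s, finite_irreducible_cover X s.
  by move=> Xc XY nYX; apply: contrapT; apply: Ymin.
have [Y0|Y0] := pselect (Y !=set0); last first.
  by apply: nY; exists [::]; split=> // v Yv; case: Y0; exists v.
have Yirr : ~ zariski_irreducible Y.
  by move=> Yi; apply: nY; exists [:: Y]; split=> [W [<-|//]|v Yv]; [split | exists Y => //; left].
apply: Yirr; split=> // A B Ac Bc YAB; apply: contrapT => /not_orP[nA nB].
have [|||s1 [s1P s1c]] := Ymin (Y `&` A).
- exact: zariski_closedI.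
- exact: subIsetl.
- by move=> H; apply: nA => v /H[].
have [|||s2 [s2P s2c]] := Ymin (Y `&` B).
- exact: zariski_closedI.
- exact: subIsetl.
- by move=> H; apply: nB => v /H[].
apply: nY; exists (s1 ++ s2); split=> [W /List.in_app_iff[/s1P|/s2P] [Wc Wi WX]|v Yv].
- by split=> //; apply: subset_trans WX (@subIsetl _ _ _).
- by split=> //; apply: subset_trans WX (@subIsetl _ _ _).
- have [Av|Bv] := YAB v Yv.
    by have [|W] := s1c v; [split|exists W => //; apply/List.in_app_iff; left].
  by have [|W] := s2c v; [split|exists W => //; apply/List.in_app_iff; right].
Qed.

End Noetherian.

(** * Degree and linear dependence of polynomials *)

Section Degree.
Variables (F : fieldType) (n : nat).
Implicit Types (p q : {mpoly F[n]}).

Lemma msizeM_bound p q a b :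
  (msize p <= a.+1 -> msize q <= b.+1 -> msize (p * q) <= (a + b).+1)%N.
Proof.
have [->|p0] := eqVneq p 0; first by rewrite mul0r msize0.
have [->|q0] := eqVneq q 0; first by rewrite mulr0 msize0.
by rewrite msizeM //; move: (msize p) (msize q) => x y; lia.
Qed.

Lemma msizeX_bound p a t : (msize p <= a.+1 -> msize (p ^+ t) <= (t * a).+1)%N.
Proof.
move=> pa; elim: t => [|t IH]; first by rewrite expr0 msize1.
by rewrite exprS mulSn; apply: msizeM_bound.
Qed.

End Degree.

Section AffineSubstitution.
Variables (F : fieldType) (n k : nat).
Implicit Types (p q : {mpoly F[n]}).

(** On an affine subspace parametrized by [k] coordinates, polynomials become
    polynomials in these coordinates; what counts is that their degree stays
    bounded. *)
Lemma msize_comp_affine (lq : n.-tuple {mpoly F[k]}) p :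
  (forall i, (msize (tnth lq i) <= 2)%N) -> (msize (p \mPo lq) <= msize p)%N.
Proof.
move=> lq2; rewrite comp_mpolyEX; apply: leq_trans (msize_sum _ _ _) _.
apply/bigmax_leqP_seq => m mp _; apply: leq_trans (msizeZ_le _ _) _.
apply: leq_trans (msize_mdeg_lt mp); rewrite comp_mpolyX mdegE.
elim/big_ind2: _ => [|a x b y xa yb|i _]; first by rewrite msize1.
- exact: msizeM_bound xa yb.
- by rewrite -[X in (_ <= X.+1)%N]muln1; apply: msizeX_bound; apply: lq2.
Qed.

End AffineSubstitution.

Section LinearDependence.
Variables (F : fieldType) (n : nat).

Lemma card_bmultinom b : (#|{: 'X_{1..n < b}}| <= b ^ n)%N.
Proof.
have small (m : 'X_{1..n < b}) i : (m i < b)%N.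
  apply: leq_ltn_trans (bmdeg m); rewrite mdegE (bigD1 i) //=; exact: leq_addr.
pose h (m : 'X_{1..n < b}) := [ffun i => Ordinal (small m i)].
have h_inj : injective h.
  move=> m1 m2 /ffunP E; apply/val_inj/mnmP => i.
  by have := E i; rewrite !ffunE => /(congr1 val).
by have := leq_card h h_inj; rewrite card_ffun !card_ord.
Qed.

(** More polynomials than there are monomials: the matrix of coefficients has a
    nonzero kernel. *)
Lemma mpoly_dependent b (T : finType) (g : T -> {mpoly F[n]}) :
  (forall t, (msize (g t) <= b)%N) -> (b ^ n < #|T|)%N ->
  exists c : T -> F, \sum_t c t *: g t = 0 /\ exists t, c t != 0.
Proof.
move=> gb lt_bT.
pose M := \matrix_(t < #|T|, m < #|{: 'X_{1..n < b}}|) (g (enum_val t))@_(enum_val m).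
have : kermx M != 0.
  rewrite -mxrank_eq0 mxrank_ker subn_eq0 -ltnNge.
  exact: leq_ltn_trans (rank_leq_col M) (leq_ltn_trans (card_bmultinom b) lt_bT).
move=> /rowV0Pn[w /sub_kermxP wM w0].
exists (fun t => w ord0 (enum_rank t)); split; last first.
  have /rV0Pn[t wt] := w0.
  by exists (enum_val t); rewrite enum_valK.
apply/mpolyP => m; rewrite mcoeff0 raddf_sum /=.
have [mb|bm] := ltnP (mdeg m) b; last first.
  apply: big1 => t _; rewrite mcoeffZ memN_msupp_eq0 ?mulr0 //.
  exact: msize_mdeg_ge (leq_trans (gb t) bm).
have := congr1 (fun A : 'rV_ _ => A ord0 (enum_rank (BMultinom mb))) wM.
rewrite !mxE (reindex (@enum_rank T)) /=; last exact/onW_bij/enum_rank_bij.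
by move=> E; rewrite -[RHS]E; apply: eq_bigr => t _; rewrite mcoeffZ !mxE !enum_rankK.
Qed.

End LinearDependence.

Section Dimension.
Variables (R : realType) (d : nat).
Local Notation C := R[i].
Implicit Types (Z V : set 'rV[C]_d) (p q : {mpoly C[d]}) (v : 'rV[C]_d).

(** * Affine subspaces *)

Definition affine_subspace (x0 : 'rV[C]_d) m (A : 'M[C]_(m, d)) : set 'rV[C]_d :=
  [set v | (v - x0 <= A)%MS].

Lemma affine_subspace_closed x0 m (A : 'M[C]_(m, d)) :
  zariski_closed (affine_subspace x0 A).
Proof.
pose ell j : {mpoly C[d]} :=
  \sum_i (cokermx A i j) *: ('X_i - (x0 ord0 i)%:MP).
have ellE j v : (ell j).@[v ord0] = ((v - x0) *m cokermx A) ord0 j.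
  rewrite mxE raddf_sum; apply: eq_bigr => i _ /=.
  by rewrite mevalZ mevalB mevalXU mevalC !mxE mulrC.
exists (range ell); apply/seteqP; split=> v.
  by rewrite /affine_subspace /= submxE => /eqP vA _ [j _ <-]; rewrite ellE vA mxE.
move=> H; rewrite /affine_subspace /= submxE; apply/eqP/rowP => j.
by rewrite -ellE mxE; apply: H; exists j.
Qed.

Lemma affine_subspace_irreducible x0 m (A : 'M[C]_(m, d)) :
  zariski_irreducible (affine_subspace x0 A).
Proof.
apply: irreducible_of_lines.
  by exists x0; rewrite /affine_subspace /= subrr sub0mx.
rewrite /affine_subspace /= => v w t vA wA.
rewrite addrAC addmx_sub // scalemx_sub //.
have -> : w - v = (w - x0) + -1 *: (v - x0) by rewrite scaleN1r opprB addrA subrK.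
by rewrite addmx_sub // scalemx_sub.
Qed.

Lemma affine_subspaceS x0 m1 m2 (A : 'M[C]_(m1, d)) (B : 'M[C]_(m2, d)) :
  affine_subspace x0 A `<=` affine_subspace x0 B <-> (A <= B)%MS.
Proof.
rewrite /affine_subspace; split=> [AB|AB v /= vA]; last exact: submx_trans AB.
apply/row_subP => i; have := AB (row i A + x0).
by rewrite /= addrK; apply; apply: row_sub.
Qed.

Lemma irreducible_chainS V W n :
  V `<=` W -> irreducible_chain V n -> irreducible_chain W n.
Proof.
move=> VW [Z [ZP Zinc]]; exists Z; split=> // i /ZP[Zc Zi ZV].
by split=> //; apply: subset_trans VW.
Qed.

(** The chain is a complete flag: its [i]th member is spanned by the first [i]
    vectors of a basis of the row space. *)
Lemma affine_subspace_chain x0 m (A : 'M[C]_(m, d)) :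
  irreducible_chain (affine_subspace x0 A) (\rank A).
Proof.
pose flag i := (pid_mx i : 'M_(\rank A)) *m row_base A.
exists (fun i => affine_subspace x0 (flag i)); split=> i ir.
  split; [exact: affine_subspace_closed | exact: affine_subspace_irreducible |].
  by apply/affine_subspaceS; apply: submx_trans (submxMl _ _) _; rewrite eq_row_base.
split; rewrite affine_subspaceS.
  apply: submxMr; apply/submxP; exists (pid_mx i).
  by rewrite mul_pid_mx; congr pid_mx; lia.
move=> /mxrankS; rewrite !mxrankMfree ?row_base_free // !rank_pid_mx ?(ltnW ir) //.
by rewrite ltnn.
Qed.

(** * Upper bound on the length of chains *)

Definition independent_on Z (T : finType) (g : T -> {mpoly C[d]}) : Prop :=
  forall c : T -> C, vanishing_ideal Z (\sum_t c t *: g t) -> forall t, c t = 0.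

(** In a relation between the products, the lowest power of [f] can be divided out
    on [Z], where the polynomial functions form a domain; what is left, restricted
    to [Y] where [f] vanishes, is a relation between the [g]. *)
Lemma independent_on_powers Y Z f (T : finType) (g : T -> {mpoly C[d]}) N :
  zariski_irreducible Z -> Y `<=` Z -> vanishing_ideal Y f -> ~ vanishing_ideal Z f ->
  independent_on Y g ->
  independent_on Z (fun t : 'I_N * T => f ^+ t.1 * g t.2).
Proof.
move=> Zirr YZ Yf nZf gind c Hc.
have powers l p : vanishing_ideal Z (f ^+ l * p) -> vanishing_ideal Z p.
  elim: l => [|l IH]; first by rewrite expr0 mul1r.
  by rewrite exprS -mulrA => /(irreducible_vanishingM Zirr)[|/IH].
suff H l : forall t : 'I_N, (t < l)%N -> forall tau, c (t, tau) = 0.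
  by case=> t tau; apply: (H N).
elim: l => // l IH t; rewrite ltnS leq_eqVlt => /orP[/eqP tl|]; last exact: IH.
pose G (t' : 'I_N) := \sum_tau c (t', tau) *: g tau.
pose r := \sum_(t' < N | (l < t')%N) f ^+ (t' - l).-1 * G t'.
suff : vanishing_ideal Z (G t + f * r).
  move=> H; apply: gind => v Yv; have := H v (YZ v Yv).
  by rewrite mevalD mevalM (Yf v Yv) mul0r addr0.
apply: (powers l) => v Zv; have := Hc v Zv.
suff -> : \sum_t0 c t0 *: (f ^+ t0.1 * g t0.2) = f ^+ l * (G t + f * r) by [].
transitivity (\sum_(t' < N) f ^+ t' * G t').
  transitivity (\sum_(t' < N) \sum_tau c (t', tau) *: (f ^+ t' * g tau)).
    by rewrite pair_bigA /=; apply: eq_bigr => -[].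
  apply: eq_bigr => t' _; rewrite mulr_sumr; apply: eq_bigr => tau _.
  by rewrite scalerAr.
rewrite (bigID (fun t' : 'I_N => (t' < l)%N)) /= big1 ?add0r => [|t' lt_t']; last first.
  by rewrite /G big1 ?mulr0 // => tau _; rewrite IH // scale0r.
rewrite (bigD1 t) /= ?tl ?ltnn // mulrDr; congr (_ + _).
rewrite mulrA -exprSr mulr_sumr; apply: eq_big => t'.
  by rewrite -leqNgt ltn_neqAle andbC eq_sym -tl.
rewrite -leqNgt => /andP[lt tt]; rewrite mulrA -exprD; congr (f ^+ _ * _).
suff : (t' : nat) != l by lia.
by rewrite -tl.
Qed.

(** The constant [s] bounds the sum of the degrees of the polynomials [f] chosen
    along the chain; [g] lists the products of their powers with exponents less
    than [N]. That [s] does not depend on [N] is essential for the counting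
    argument. *)
Lemma chain_independent V n : irreducible_chain V n ->
  exists s, forall N, exists (T : finType) (g : T -> {mpoly C[d]}),
    [/\ #|T| = (N ^ n)%N, forall t, (msize (g t) <= (s * N).+1)%N & independent_on V g].
Proof.
move=> [Z [ZP Zinc]].
suff [s sP] : exists s, forall N, exists (T : finType) (g : T -> {mpoly C[d]}),
    [/\ #|T| = (N ^ n)%N, forall t, (msize (g t) <= (s * N).+1)%N & independent_on (Z n) g].
  exists s => N; have [T [g [cT gs gind]]] := sP N; exists T, g; split=> // c Vc.
  by apply: gind => v Zv; apply: Vc; have [_ _] := ZP n (leqnn n); apply.
elim: {1 3 4}n (leqnn n) => [_|k IH kn].
  exists 0 => N; exists unit, (fun=> 1); split=> [|_|c Hc []]; first by rewrite card_unit.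
    by rewrite msize1.
  have [_ [[v Zv] _] _] := ZP 0 isT; have := Hc v Zv.
  by rewrite (big_pred1 tt) /= => [|[]//]; rewrite mevalZ meval1 mulr1.
have [s sP] := IH (ltnW kn).
have [Zkc _ _] := ZP k (ltnW kn); have [_ Zk1i _] := ZP k.+1 kn.
have [f Zf [v Zv fv]] := zariski_closed_separated Zkc (proj2 (Zinc k kn)).
exists (s + msize f)%N => N; have [T [g [cT gs gind]]] := sP N.
exists ('I_N * T)%type, (fun t : 'I_N * T => f ^+ t.1 * g t.2); split.
- by rewrite card_prod card_ord cT expnS.
- move=> [t tau] /=; have := @msizeX_bound _ _ f (msize f) t (leqnSn _).
  move=> /msizeM_bound /(_ (gs tau)) /leq_trans; apply; rewrite ltnS.
  by have := ltn_ord t; nia.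
- apply: independent_on_powers gind => //; first exact: (proj1 (Zinc k kn)).
  by move=> /(_ v Zv)/eqP; apply/negP.
Qed.

(** Counting: the [N ^ n] independent products have degree [O(N)], and the
    polynomials of degree [O(N)] on an affine subspace of dimension [r] form a
    space of dimension [O(N ^ r)]. *)
Lemma chain_le_rank V x0 m (A : 'M[C]_(m, d)) n :
  V `<=` affine_subspace x0 A -> irreducible_chain V n -> (n <= \rank A)%N.
Proof.
move=> VA /(irreducible_chainS VA)/chain_independent[s sP].
rewrite leqNgt; apply/negP => lt_rn; pose r := \rank A.
(* [N] is such that [((s + 1) N) ^ r < N ^ (r + 1)]. *)
have [T [g [cT gs gind]]] := sP ((s.+1 ^ r).+1).
set N := (s.+1 ^ r).+1 in cT gs.
(* The parametrization of the affine subspace by [r] coordinates. *)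
pose lq := [tuple (x0 ord0 i)%:MP + \sum_(j < r) (row_base A j i) *: 'X_j | i < d].
have lqE (y : 'rV_r) i : (tnth lq i).@[y ord0] = (x0 + y *m row_base A) ord0 i.
  rewrite tnth_mktuple mevalD mevalC !mxE raddf_sum; congr (_ + _).
  by apply: eq_bigr => j _; rewrite /= mevalZ mevalXU mulrC.
have lq2 i : (msize (tnth lq i) <= 2)%N.
  rewrite tnth_mktuple; apply: leq_trans (msizeD_le _ _) _; rewrite geq_max.
  rewrite msizeC (leq_trans (leq_b1 _)) //=; apply: leq_trans (msize_sum _ _ _) _.
  apply/bigmax_leqP => j _; apply: leq_trans (msizeZ_le _ _) _.
  by rewrite msizeX mdeg1.
have [||c [c0 [t ct]]] := @mpoly_dependent _ r (s * N).+1 T (fun t => g t \mPo lq).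
- by move=> t; apply: leq_trans (msize_comp_affine _ lq2) (gs t).
- rewrite cT; apply: (@leq_trans (N ^ r.+1)); last exact: leq_pexp2l.
  apply: (@leq_ltn_trans ((s.+1 * N) ^ r)).
    have : ((s * N).+1 <= s.+1 * N)%N by rewrite mulSn -[in X in (X <= _)%N]addn1 addnC leq_add2r.
    by case: (r) => // r'; rewrite leq_exp2r.
  by rewrite expnMn expnS ltn_pmul2r // expn_gt0.
move/eqP: ct; apply; apply: gind => v.
rewrite /affine_subspace /= -(eq_row_base A) => /submxP[y vE].
have -> : v = x0 + y *m row_base A by rewrite -vE addrC subrK.
transitivity ((\sum_t c t *: g t) \mPo lq).@[y ord0].
  by rewrite comp_mpoly_meval; apply: meval_eq => i; rewrite lqE.
suff -> : (\sum_t c t *: g t) \mPo lq = 0 by rewrite meval0.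
by rewrite raddf_sum -[RHS]c0; apply: eq_bigr => t' _; apply: comp_mpolyZ.
Qed.

Lemma has_dim_affine_subspace x0 m (A : 'M[C]_(m, d)) :
  has_dim (affine_subspace x0 A) (\rank A).
Proof.
split; first exact: affine_subspace_chain.
by move=> n; apply: (@chain_le_rank _ x0 m A).
Qed.

Lemma chain_le_dim V n : irreducible_chain V n -> (n <= d)%N.
Proof.
move=> /(@chain_le_rank V 0 _ 1%:M n); rewrite mxrank1; apply.
by move=> v _; rewrite /affine_subspace /= submx1.
Qed.

(** Chains have bounded length, so a closed set with one chain has a dimension. *)
Lemma dim_ge_chain V k : irreducible_chain V k -> dim_ge V k.
Proof.
move=> Vk; pose P n := `[< irreducible_chain V n >].
have [||n /asboolP Vn nmax] := @ex_maxnP P d.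
- by exists k; apply/asboolP.
- by move=> n /asboolP/chain_le_dim.
by exists n; [split=> // j Vj|]; apply: nmax; apply/asboolP.
Qed.

End Dimension.

(** * McCoy's theorem for difference operators *)

Lemma seq_argmin (T : eqType) (K : realDomainType) (f : T -> K) (x : T) (s : seq T) :
  exists2 y, y \in x :: s & {in x :: s, forall z, f y <= f z}.
Proof.
elim: s => [|x' s [y ys ymin]]; first by exists x => [|z]; rewrite inE // => /eqP->.
have [lt|ge] := leP (f y) (f x').
  exists y => [|z]; first by move: ys; rewrite !inE => /orP[|] ->; rewrite ?orbT.
  rewrite !inE => /or3P[/eqP->|/eqP->//|zs]; first by apply: ymin; rewrite inE eqxx.
  by apply: ymin; rewrite inE zs orbT.
exists x' => [|z]; first by rewrite !inE eqxx orbT.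
rewrite !inE => /or3P[/eqP->|/eqP->//|zs]; apply: le_trans (ltW ge) _; apply: ymin.
  by rewrite inE eqxx.
by rewrite inE zs orbT.
Qed.

Section McCoy.
Variables (G : zmodType) (F : fieldType) (K : realDomainType).
Implicit Types (f g : G -> F) (v w : G -> G -> F).

(** The equations hold modulo a space of negligible functions on [G], and the
    degrees are the classes of [G] modulo the subgroup [H]. They are compared
    through the form [psi], which separates the classes of the exponents [ev j]
    of the operator. *)
Variable negligible : (G -> F) -> Prop.
Hypothesis negligible0 : negligible (fun=> 0).
Hypothesis negligibleD : forall f g,
  negligible f -> negligible g -> negligible (fun x => f x + g x).
Hypothesis negligibleZ : forall a f, negligible f -> negligible (fun x => a * f x).
Hypothesis negligible_shift : forall e f, negligible f -> negligible (fun x => f (x + e)).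

Variable H : G -> Prop.
Variable psi : {additive G -> K}.
Hypothesis psiH : forall a, H a -> psi a = 0.
Hypothesis HB : forall a b, H a -> H b -> H (a - b).

Variables (J : finType) (c : J -> F) (ev : J -> G).
Hypothesis psi_inj : forall j k, psi (ev j) = psi (ev k) -> H (ev j - ev k).

(** A family [v] is a graded vector: [v b] is its component in the degree of
    [b] modulo [H], and [part P v] is its image under the terms of the
    difference operator indexed by [P]. *)
Definition part (P : pred J) v b : G -> F :=
  fun x => \sum_(j | P j) c j * v (b + ev j) (x + ev j).

Lemma negligible_sum (P : pred J) (h : J -> G -> F) :
  (forall j, P j -> negligible (h j)) -> negligible (fun x => \sum_(j | P j) h j x).
Proof.
move=> hn; rewrite (_ : (fun x => _) = (\sum_(j | P j) h j)%R); last first.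
  by apply/funext => x; rewrite fct_sumE.
by apply: (big_ind negligible) => // f g; apply: negligibleD.
Qed.

Lemma negligible_term v b j :
  negligible (v (b + ev j)) -> negligible (fun x => c j * v (b + ev j) (x + ev j)).
Proof. by move=> ?; apply/negligibleZ/negligible_shift. Qed.

Lemma negligible_part (P : pred J) v b :
  (forall j, P j -> negligible (v (b + ev j))) -> negligible (part P v b).
Proof. by move=> vn; apply: negligible_sum => j /vn; apply: negligible_term. Qed.

Lemma partC (P Q : pred J) v b : part P (part Q v) b = part Q (part P v) b.
Proof.
apply/funext => x; rewrite /part; under eq_bigr do rewrite mulr_sumr.
rewrite exchange_big; apply: eq_bigr => k _; rewrite mulr_sumr; apply: eq_bigr => j _.
by rewrite mulrCA [b + _ + _]addrAC [x + _ + _]addrAC.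
Qed.

(** The size of [B] bounds the number of nonzero components, and the proof of
    McCoy's theorem is an induction on it. *)
Definition graded_solution (B : seq G) v : Prop :=
  [/\ forall a b, H (a - b) -> v a = v b,
      forall b, ~ negligible (v b) -> exists2 b0, b0 \in B & H (b - b0) &
      forall b, negligible (part predT v b)].

Definition level (j0 : J) : pred J := [pred j | psi (ev j) == psi (ev j0)].

(** Consider the degree in which the terms of degree [ev j0] meet the component of
    [v] of minimal degree. Nothing else contributes to it: the higher terms kill
    [v], and the lower ones would need a component of smaller degree. Hence the
    image of [v] under the terms of degree [ev j0] vanishes there, and its
    support is smaller than that of [v]. *)
Lemma graded_solution_level B v (U : pred J) j0 bmin :
  graded_solution B v -> {in B, forall b, psi bmin <= psi b} ->
  (forall j, U j -> psi (ev j0) <= psi (ev j)) ->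
  (forall j, psi (ev j0) <= psi (ev j) -> U j) ->
  (forall b, negligible (part (fun j => U j && (psi (ev j) != psi (ev j0))) v b)) ->
  graded_solution [seq b - ev j0 | b <- B & b != bmin] (part (level j0) v).
Proof.
move=> [vper vB veq] bmin_le geU Uge vU.
have wper a b : H (a - b) -> part (level j0) v a = part (level j0) v b.
  move=> Hab; apply/funext => x; apply: eq_bigr => j _.
  by rewrite (vper (a + ev j) (b + ev j)) // opprD addrACA subrr addr0.
have wmin : negligible (part (level j0) v (bmin - ev j0)).
  set b := bmin - ev j0.
  pose low x := \sum_(j | ~~ U j) c j * v (b + ev j) (x + ev j).
  have low_negl : negligible low.
    apply: negligible_part => j nUj; apply: contrapT => /vB[b0 b0B /psiH].
    rewrite raddfB raddfD raddfB /= => /eqP; rewrite subr_eq0 => /eqP E.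
    have := bmin_le b0 b0B; rewrite -E leNgt => /negP; apply.
    rewrite -addrA gtrDl addrC subr_lt0 ltNge; apply/negP => /Uge Uj.
    by rewrite Uj in nUj.
  have -> : part (level j0) v b = (fun x => part predT v b x +
      (-1 * part (fun j => U j && (psi (ev j) != psi (ev j0))) v b x + -1 * low x)).
    apply/funext => x; rewrite /part /low [X in _ = X + _](bigID U) /=.
    rewrite [X in _ = X + _ + _](bigID (level j0)) /= !mulN1r.
    rewrite (eq_bigl (fun j => U j && level j0 j)) => [|j]; last first.
      by rewrite /level /= andbC; case: eqP => // E; rewrite /= Uge // E.
    by rewrite -opprD -[X in _ = X - _]addrA addrK.
  apply: negligibleD; first exact: veq.
  by apply: negligibleD; apply: negligibleZ.
split=> // [b nwb|b].
  have [j [/eqP lj nvj]] : exists j, level j0 j /\ ~ negligible (v (b + ev j)).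
    apply: contrapT => /forallNP nv; apply: nwb; apply: negligible_part => j lj.
    by apply: contrapT => nvj; apply: (nv j).
  have [b0 b0B Hb0] := vB _ nvj.
  have Hb : H (b - (b0 - ev j0)).
    rewrite (_ : b - _ = (b + ev j - b0) - (ev j - ev j0)); first exact/HB/psi_inj.
    rewrite !opprB (addrAC b) -(addrA (b - b0)) (addrCA (ev j)) subrr addr0.
    by rewrite -addrA (addrC (- b0)).
  exists (b0 - ev j0) => //; apply: map_f; rewrite mem_filter b0B andbT.
  by apply/eqP => E; apply: nwb; rewrite (wper _ _ Hb) E.
by rewrite partC; apply: negligible_part => j _; apply: veq.
Qed.

(** McCoy's theorem says that, if a nonzero solution exists, the homogeneous parts
    of the operator have a common one. A part which is a single invertible term
    excludes this. *)
Lemma mccoy B v j0 : c j0 != 0 ->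
  (forall j, j != j0 -> c j != 0 -> ~ H (ev j - ev j0)) ->
  graded_solution B v -> forall b, negligible (v b).
Proof.
move=> c0 alone.
move: {2}(size B) (leqnn (size B)) => n; elim: n B v => [|n IH] B v sB vsol.
  move: sB; rewrite leqn0 => /nilP B0 b; apply: contrapT => nvb.
  by have [_ /(_ b nvb)[b0]] := vsol; rewrite B0.
have [/nilP B0|] := boolP (nilp B); first by apply: (IH B) => //; rewrite B0.
case: B sB vsol => // b1 B' sB vsol _; have [bmin bminB bmin_le] := seq_argmin psi b1 B'.
pose up (U : {set J}) := forall j k, j \in U -> psi (ev j) <= psi (ev k) -> k \in U.
(* By the induction hypothesis the image of [v] under the lowest part of [U]
   vanishes, once all the higher parts kill [v]. *)
have level_negl (U : {set J}) j : up U -> j \in U ->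
    (forall k, k \in U -> psi (ev j) <= psi (ev k)) ->
    (forall b, negligible (part (fun k => (k \in U) && (psi (ev k) != psi (ev j))) v b)) ->
    forall b, negligible (part (level j) v b).
  move=> Uup Uj Uge vU.
  apply: (IH [seq b - ev j | b <- b1 :: B' & b != bmin]); last first.
    by apply: (graded_solution_level vsol bmin_le Uge) => // k; apply: Uup.
  rewrite size_map size_filter -ltnS; apply: leq_trans sB.
  rewrite -(count_predC (fun b => b != bmin)) -[X in (X < _)%N]addn0 ltn_add2l -has_count.
  by apply/hasP; exists bmin => //=; rewrite negbK.
(* The parts of the operator are peeled off from the highest one down. *)
have up_negl (U : {set J}) : up U -> forall b, negligible (part (fun k => k \in U) v b).
  move: {2}#|U| (leqnn #|U|) => m; elim: m U => [|m IHm] U cU Uup b.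
    move: cU; rewrite leqn0 cards_eq0 => /eqP U0.
    by apply: negligible_part => j; rewrite U0 inE.
  have [->|/set0Pn[i Ui]] := eqVneq U finset.set0.
    by apply: negligible_part => j; rewrite inE.
  case: (arg_minP (fun j => psi (ev j)) Ui) => j Uj jmin.
  pose U' := [set k in U | psi (ev k) != psi (ev j)]%SET.
  have U'_negl b' : negligible (part (fun k => k \in U') v b').
    apply: IHm => [|k l].
      rewrite -ltnS; apply: leq_trans cU; apply: proper_card.
      apply/fintype.properP; split; last by exists j; rewrite // inE eqxx andbF.
      by apply/fintype.subsetP => k; rewrite inE => /andP[].
    rewrite !inE => /andP[Uk kj] kl; rewrite (Uup k) //=.
    have : psi (ev j) < psi (ev k) by rewrite lt_neqAle eq_sym kj jmin.
    by move=> /lt_le_trans/(_ kl)/gt_eqF ->.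
  have U'E : (fun k => (k \in U) && (psi (ev k) != psi (ev j))) = (fun k => k \in U').
    by apply/funext => k; rewrite /= inE.
  have lev_negl := level_negl U j Uup Uj jmin.
  rewrite U'E in lev_negl.
  have -> : part (fun k => k \in U) v b = (fun x => part (level j) v b x + part (fun k => k \in U') v b x).
    apply/funext => x; rewrite /part (bigID (level j)) /=; congr (_ + _).
      apply: eq_bigl => k; rewrite /level /=; apply/andP/idP => [[]//|/eqP E].
      by split; rewrite ?E // (Uup j) // E.
    by apply: eq_bigl => k; rewrite inE.
  by apply: negligibleD; [exact: lev_negl | exact: U'_negl].
have lev_negl b : negligible (part (level j0) v b).
  pose U := [set k | psi (ev j0) <= psi (ev k)]%SET.
  apply: (level_negl U j0) => [k l||k|b'].
  - by rewrite !inE => /le_trans h /h.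
  - by rewrite inE.
  - by rewrite inE.
  pose U' := [set k | psi (ev j0) < psi (ev k)]%SET.
  rewrite (_ : (fun k => _) = (fun k => k \in U')); last first.
    by apply/funext => k; rewrite /= !inE lt_neqAle eq_sym andbC.
  by apply: up_negl => k l; rewrite !inE; apply: lt_le_trans.
have vE b x : v b x = (c j0)^-1 * part (level j0) v (b - ev j0) (x - ev j0).
  rewrite /part (bigD1 j0) /=; last exact: eqxx.
  rewrite big1 => [|j /andP[/eqP lj jj0]]; first by rewrite addr0 !subrK mulKf.
  have [->|cj] := eqVneq (c j) 0; first by rewrite mul0r.
  by case: (alone j jj0 cj); apply: psi_inj.
move=> b; have -> : v b = fun x =>
    (c j0)^-1 * part (level j0) v (b - ev j0) (x - ev j0) by apply/funext.
by apply: negligibleZ; apply: (@negligible_shift (- ev j0)); apply: lev_negl.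
Qed.

End McCoy.

(** * Directions of a closed set *)

Section Linear.

(** Among the matrices whose row space satisfies [P], one of maximal rank. *)
Lemma subspace_rowspace (F : fieldType) n (P : 'rV[F]_n -> Prop) :
  P 0 -> (forall a v w, P v -> P w -> P (a *: v + w)) ->
  exists A : 'M[F]_n, forall w, P w <-> (w <= A)%MS.
Proof.
move=> P0 Plin; pose Q k := `[< exists A : 'M[F]_n, \rank A = k /\
  forall w, (w <= A)%MS -> P w >].
have [||k /asboolP[A [rA AP]] kmax] := @ex_maxnP Q n.
- exists 0; apply/asboolP; exists 0; split; first exact: mxrank0.
  by move=> w; rewrite submx0 => /eqP ->.
- by move=> k /asboolP[A [<- _]]; apply: rank_leq_col.
exists A => w; split=> [Pw|]; last exact: AP.
rewrite -[X in is_true X]negbK; apply/negP => nwA.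
have /kmax : Q (\rank (A + w)%MS).
  apply/asboolP; exists (A + w)%MS; split=> // x /sub_addsmxP[[y z] /= ->].
  rewrite addrC [z]mx11_scalar mul_scalar_mx; apply: Plin => //.
  by apply: AP; apply: submxMl.
rewrite -rA leqNgt => /negP; apply.
have : (A < A + w)%MS.
  rewrite /ltmx addsmxSl /=; apply: contra nwA => /(submx_trans _); apply.
  exact: addsmxSr.
by rewrite ltmxErank => /andP[].
Qed.

Lemma avoid_roots (F : numDomainType) (T : eqType) (p : T -> {poly F}) (s : seq T) :
  {in s, forall x, p x != 0} -> exists k : nat, {in s, forall x, (p x).[k%:R] != 0}.
Proof.
move=> ps; pose q := \prod_(x <- s) p x.
have q0 : q != 0 by rewrite prodf_seq_neq0; apply/allP => x /ps.
apply: contrapT => H; have Hall : all (root q) [seq k%:R | k <- iota 0 (size q)].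
  apply/allP => _ /mapP[k _ ->]; apply: contrapT => qk; apply: H; exists k => x xs.
  apply/eqP => px; apply: qk; rewrite rootE /q (big_rem x) //= hornerM px mul0r.
  exact: eqxx.
have Huniq : uniq [seq k%:R : F | k <- iota 0 (size q)].
  by rewrite map_inj_uniq ?iota_uniq // => m k /eqP; rewrite eqr_nat => /eqP.
by have := max_poly_roots q0 Hall Huniq; rewrite size_map size_iota ltnn.
Qed.

(** The values of a vector at a generic point of the moment curve
    [(1, t, t ^ 2, ...)] give a complex form which detects finitely many given
    nonzero vectors of the quotient, and [Re + tau Im] for a generic [tau] makes it
    real. *)
Lemma separating_form (R : realType) n (A : 'M[R[i]]_n) (s : seq 'rV[R[i]]_n) :
  {in s, forall w, ~~ (w <= A)%MS} ->
  exists psi : {additive 'rV[R[i]]_n -> R},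
    (forall w, (w <= A)%MS -> psi w = 0) /\ {in s, forall w, psi w != 0}.
Proof.
move=> sA; pose p w := rVpoly (w *m cokermx A).
have [|t tP] := @avoid_roots _ _ p s.
  move=> w /sA; rewrite submxE; apply: contraNneq => pw.
  by rewrite -[_ *m _]rVpolyK [rVpoly _]pw linear0.
pose z w := (p w).[t%:R].
pose q w : {poly R} := (complex.Re (z w))%:P + complex.Im (z w) *: 'X.
have [|tau tauP] := @avoid_roots _ _ q s.
  move=> w /tP; apply: contraNneq => qw; rewrite -/(z w).
  have := congr1 (fun r : {poly R} => r`_0) qw; have := congr1 (fun r : {poly R} => r`_1) qw.
  rewrite !coefD !coefC !coefZ !coefX /= mulr0 mulr1 add0r addr0.
  by case: (z w) => x y /= -> ->.
pose psi w : R := (q w).[tau%:R].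
have psiB : {morph psi : v w / v - w}.
  move=> v w; have zB : z (v - w) = z v - z w.
    by rewrite /z /p mulmxBl linearB hornerD hornerN.
  by rewrite /psi /q zB; case: (z v) (z w) => a b [a' b']; rewrite !hornerE /=; ring.
pose psiM := GRing.isZmodMorphism.Build _ _ psi psiB.
pose psiA : {additive _ -> _} := HB.pack psi psiM.
exists psiA; split=> [w|w /tauP //] /=.
rewrite submxE => /eqP wA; rewrite /psi /q /z /p wA linear0 horner0 /=.
by rewrite scale0r addr0 hornerC.
Qed.

End Linear.

Section Directions.
Variables (R : realType) (d : nat).
Local Notation C := R[i].
Implicit Types (Z : set 'rV[C]_d) (a b v w : 'rV[C]_d) (e x : 'rV[int]_d).

Definition direction Z w : Prop := forall v (t : C), Z v -> Z (v + t *: w).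

Lemma direction_rowspace Z :
  exists A : 'M[C]_d, forall w, direction Z w <-> (w <= A)%MS.
Proof.
apply: subspace_rowspace => [v t|a v w dv dw u t Zu]; first by rewrite scaler0 addr0.
by rewrite scalerDr scalerA addrA; apply: dw; apply: dv.
Qed.

(** With each of its points [v], the set [Z] contains [v], [v + a], [v + 2 a] and
    so on, hence the whole line through [v]. *)
Lemma closed_direction Z a : zariski_closed Z -> Z `<=` translate (- a) Z ->
  direction Z a.
Proof.
move=> Zc Za v t Zv; apply: line_in_closed => // k; elim: k => [|k IH].
  by rewrite scale0r addr0.
by have := Za _ IH; rewrite /translate /= opprK -addrA -natr1 scalerDl scale1r.
Qed.

Lemma direction_translate Z a : direction Z a -> translate a Z = Z.
Proof.
move=> da; apply/seteqP; split=> v Zv.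
  by have := da _ 1 Zv; rewrite scale1r subrK.
by have := da _ (-1) Zv; rewrite scaleN1r.
Qed.

Lemma chain_of_directions Z m (A : 'M[C]_(m, d)) : Z !=set0 ->
  (forall w, (w <= A)%MS -> direction Z w) -> irreducible_chain Z (\rank A).
Proof.
move=> [v0 Zv0] AZ; apply: irreducible_chainS (@affine_subspace_chain R d v0 m A).
by move=> v /AZ/(_ v0 1 Zv0); rewrite scale1r addrC subrK.
Qed.

(** The top [V0] of a longest chain: since a translate of a chain is a chain,
    nothing irreducible inside [V] lies strictly above a translate of [V0]. *)
Lemma top_of_longest_chain V : V !=set0 ->
  exists V0, [/\ zariski_closed V0, zariski_irreducible V0, V0 `<=` V &
    forall a Y, zariski_closed Y -> zariski_irreducible Y -> Y `<=` V ->
      translate a V0 `<=` Y -> Y `<=` translate a V0].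
Proof.
move=> [v Vv]; have [n [[Z [ZP Zinc]] nmax] _] : dim_ge V 0.
  apply: dim_ge_chain; have := @affine_subspace_chain R d v d 0.
  rewrite mxrank0; apply: irreducible_chainS => w.
  by rewrite /affine_subspace /= submx0 subr_eq0 => /eqP ->.
have [Zc Zi ZV] := ZP n (leqnn n).
have Zmono j k : (j <= k)%N -> (k <= n)%N -> Z j `<=` Z k.
  elim: k => [|k IH]; first by rewrite leqn0 => /eqP-> _ v0.
  rewrite leq_eqVlt => /orP[/eqP-> _ v0 //|jk] kn.
  exact: subset_trans (IH jk (ltnW kn)) (proj1 (Zinc k kn)).
exists (Z n); split=> // a Y Yc Yi YV ZY; apply: contrapT => nYZ.
have := nmax n.+1; rewrite ltnn => H; suff : false by []; apply: H.
exists (fun i => if (i <= n)%N then translate a (Z i) else Y); split=> i.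
  case: ifP => // lein _; have [Zic Zii _] := ZP i lein; split.
  - exact: zariski_closed_translate.
  - exact: zariski_irreducible_translate.
  - apply: subset_trans YV; apply: subset_trans ZY; apply: translateS.
    exact: Zmono.
rewrite ltnS => lein; rewrite lein; case: ifP => [lt_in|/negbT].
  exact/translate_proper/Zinc.
by rewrite -ltnNge ltnS => ni; have -> : i = n by apply/eqP; rewrite eqn_leq lein.
Qed.

(** Split off the pieces one at a time: the closure of a union of two sets is the
    union of their closures, and the irreducible [Z] lies in one of them. *)
Lemma irreducible_sub_closure Z S (s : seq (set 'rV[C]_d)) :
  zariski_irreducible Z -> Z `<=` zariski_closure S ->
  (forall v, S v -> exists2 Y, List.In Y s & Y v) ->
  exists2 Y, List.In Y s & Z `<=` zariski_closure (S `&` Y).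
Proof.
move=> Zi; elim: s S => [|X s IH] S ZS Ss.
  case: Zi => -[v /ZS Zv] _; exfalso.
  have /Zv : vanishing_ideal S 1 by move=> w /Ss[].
  by rewrite meval1; apply/eqP; apply: oner_neq0.
have ZU : Z `<=` zariski_closure (S `&` X) `|` zariski_closure (S `\` X).
  apply: subset_trans ZS (subset_trans _ (@zariski_closure_setU _ _ _ _)).
  apply: zariski_closureS => v Sv; have [Xv|nXv] := pselect (X v); first by left.
  by right.
case: Zi => _ /(_ _ _ _ _ ZU)[||H|/IH[]].
- exact: zariski_closure_closed.
- exact: zariski_closure_closed.
- by exists X => //; left.
- by move=> v [/Ss[Y [<-|Ys] Yv] nXv] //; exists Y.
move=> Y Ys ZY; exists Y; first by right.
by apply: subset_trans ZY _; apply: zariski_closureS => v [[]].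
Qed.

Lemma irreducible_sub_cover Z (s : seq (set 'rV[C]_d)) :
  zariski_irreducible Z -> (forall Y, List.In Y s -> zariski_closed Y) ->
  (forall v, Z v -> exists2 Y, List.In Y s & Y v) ->
  exists2 Y, List.In Y s & Z `<=` Y.
Proof.
move=> Zi sc /(irreducible_sub_closure Zi (@sub_zariski_closure _ _ Z))[Y Ys ZY].
exists Y => //; apply: subset_trans ZY _; apply: zariski_closure_min; first exact: sc.
exact: subIsetr.
Qed.

End Directions.

(** * Supports of solutions of difference equations *)

Section SupportClosure.
Variables (R : realType) (d : nat).
Local Notation C := R[i].
Local Notation emb := (@lattice_embed R d).
Implicit Types (f g u : 'rV[int]_d -> C) (e x : 'rV[int]_d).

Lemma lattice_embedB x e : emb (x - e) = emb x - emb e.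
Proof. by apply/rowP => i; rewrite !mxE rmorphB. Qed.

Lemma lattice_embedD x e : emb (x + e) = emb x + emb e.
Proof. by apply/rowP => i; rewrite !mxE rmorphD. Qed.

Lemma supp_closureS f g : supp f `<=` supp g -> supp_closure f `<=` supp_closure g.
Proof. by move=> fg; apply: zariski_closureS; apply: image_subset. Qed.

Lemma supp_closure0 (Z : set 'rV[C]_d) :
  Z !=set0 -> ~ Z `<=` supp_closure (fun _ : 'rV[int]_d => 0 : C).
Proof.
move=> [v Zv] /(_ v Zv 1); rewrite meval1 => H.
have /eqP : (1 : C) = 0 by apply: H => w [x]; rewrite /supp /= eqxx.
by rewrite oner_eq0.
Qed.

Lemma supp_closureD f g :
  supp_closure (fun x => f x + g x) `<=` supp_closure f `|` supp_closure g.
Proof.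
apply: subset_trans (@zariski_closure_setU _ _ _ _); apply: zariski_closureS.
move=> _ [x fgx <-]; rewrite /supp /= in fgx.
have [fx|fx] := eqVneq (f x) 0; last by left; exists x.
by right; exists x => //; rewrite fx add0r in fgx.
Qed.

Lemma supp_closure_shift f e :
  supp_closure (fun x => f (x + e)) = translate (- emb e) (supp_closure f).
Proof.
rewrite /supp_closure -zariski_closure_translate; congr zariski_closure.
apply/seteqP; split=> [_ [x fx <-]|v [x fx xv]].
  by exists (x + e) => //; rewrite /= lattice_embedD opprK.
exists (x - e); first by rewrite /supp /= subrK.
by rewrite lattice_embedB xv opprK addrK.
Qed.

(** The rows of [A] span the directions of an irreducible component [V0] of maximal
    dimension of the closure of the support. The restrictions of [u] to the
    translates of [V0] by lattice points form a family graded by the lattice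
    modulo these directions, finite up to functions whose support is too small to
    be dense in a translate of [V0]. The equation holds degree by degree, and
    McCoy's theorem applies. *)
Theorem support_directions (J : finType) (c : J -> C) (ev : J -> 'rV[int]_d) u :
  nonzero u -> (forall x, \sum_j c j * u (x + ev j) = 0) ->
  exists A : 'M[C]_d, irreducible_chain (supp_closure u) (\rank A) /\
    forall j0, c j0 != 0 ->
      exists j, [/\ j != j0, c j != 0 & (emb (ev j) - emb (ev j0) <= A)%MS].
Proof.
move=> [x0 ux0] ueq; pose V := supp_closure u.
have Vx0 : V (emb x0) by apply: sub_zariski_closure; exists x0.
have Vc : zariski_closed V by apply: zariski_closure_closed.
have [|V0 [V0c V0i V0V V0max]] := @top_of_longest_chain R d V; first by exists (emb x0).
have [A AP] := direction_rowspace V0.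
exists A; split.
  apply: irreducible_chainS V0V _; apply: chain_of_directions; first by case: V0i.
  by move=> w /AP.
have V0eq a : translate a V0 `<=` V0 -> translate a V0 = V0.
  by move=> aV; apply/seteqP; split=> //; apply: V0max.
have dirA a : translate a V0 = V0 -> (a <= A)%MS.
  move=> aV; apply/AP; apply: closed_direction => //.
  by rewrite -[X in _ `<=` _ X]aV translateD addNr translate0.
have [s [sP scov]] := irreducible_decomposition Vc.
pose negl f := forall b : 'rV[int]_d, ~ translate (emb b) V0 `<=` supp_closure f.
have trans_irr a : zariski_irreducible (translate a V0).
  exact: zariski_irreducible_translate.
have negl0 : negl (fun=> 0).
  by move=> b; apply: supp_closure0; case: (trans_irr (emb b)).
have neglD f g : negl f -> negl g -> negl (fun x => f x + g x).
  move=> nf ng b /subset_trans/(_ (@supp_closureD f g)) fgb.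
  have [_ /(_ _ _ _ _ fgb)[||/nf|/ng]//] := trans_irr (emb b);
    exact: zariski_closure_closed.
have neglZ a f : negl f -> negl (fun x => a * f x).
  move=> nf b fb; apply: (nf b); apply: subset_trans fb _.
  by apply: supp_closureS => x; apply: contra_neq => ->; rewrite mulr0.
have negl_shift e f : negl f -> negl (fun x => f (x + e)).
  move=> nf b; rewrite supp_closure_shift => /(translateS (a := emb e)).
  by rewrite !translateD subrr translate0 -lattice_embedD; apply: nf.
pose H (b : 'rV[int]_d) : Prop := (emb b <= A)%MS.
have HB a b : H a -> H b -> H (a - b).
  by move=> Ha Hb; rewrite /H lattice_embedB addmx_sub // -scaleN1r scalemx_sub.
pose v b x : C := if `[< translate (emb b) V0 (emb x) >] then u x else 0.
have transH a b : H (a - b) -> translate (emb a) V0 = translate (emb b) V0.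
  move=> Hab; rewrite -[a](subrK b) lattice_embedD addrC -translateD.
  by rewrite [translate (emb (a - b)) V0]direction_translate //; apply/AP.
have v_supp b : supp_closure (v b) `<=` translate (emb b) V0 `&` V.
  apply: zariski_closure_min.
    by apply: zariski_closedI => //; apply: zariski_closed_translate.
  move=> _ [x vx <-]; move: vx; rewrite /supp /v /=; case: asboolP; rewrite ?eqxx //.
  by move=> bx ux; split=> //; apply: sub_zariski_closure; exists x.
(* If [v b] is not negligible, a translate of [V0] lies in the closure of its
   support, so in [V0 + b]; by maximality it is [V0 + b], which is therefore
   contained in [V] and is a component. *)
have v_comp b : ~ negl (v b) -> List.In (translate (emb b) V0) s.
  move=> /existsNP[b' /contrapT bb'].
  have {bb'} b'b := subset_trans bb' (@v_supp b).
  have E : translate (emb b' - emb b) V0 = V0.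
    apply: V0eq; have := translateS (a := - emb b) (subset_trans b'b (@subIsetl _ _ _)).
    by rewrite !translateD addNr translate0 addrC.
  have bE : translate (emb b') V0 = translate (emb b) V0.
    by rewrite -[in RHS]E translateD addrC subrK.
  have bV : translate (emb b) V0 `<=` V.
    by rewrite -bE; apply: subset_trans b'b (@subIsetr _ _ _).
  have [||Y Ys bY] := @irreducible_sub_cover _ _ (translate (emb b) V0) s (trans_irr _).
  - by move=> Y /sP[].
  - by move=> w /bV/scov.
  have [Yc Yi YV] := sP Y Ys.
  by rewrite (_ : translate _ _ = Y) //; apply/seteqP; split=> //; apply: V0max.
have [B BP] : exists B : seq 'rV[int]_d, forall b, ~ negl (v b) ->
    exists2 b0, b0 \in B & H (b - b0).
  suff [B BP] : exists B : seq 'rV[int]_d,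
      forall b, List.In (translate (emb b) V0) s -> exists2 b0, b0 \in B & H (b - b0).
    by exists B => b /v_comp/BP.
  elim: (s) => [|Y s' [B BP]]; first by exists [::].
  have [[b1 b1Y]|nY] := pselect (exists b1, translate (emb b1) V0 = Y); last first.
    by exists B => b [Yb|/BP//]; case: nY; exists b.
  exists (b1 :: B) => b [Yb|/BP[b0 b0B Hb]]; last by exists b0; rewrite // inE b0B orbT.
  exists b1; first by rewrite inE eqxx.
  rewrite /H lattice_embedB; apply: dirA; rewrite addrC -translateD -Yb -b1Y.
  by rewrite translateD addNr translate0.
have [b nvb] : exists b, ~ negl (v b).
  exists 0; apply/existsNP; exists 0; apply; rewrite /lattice_embed map_mx0 translate0.
  have [||Y Ys V0Y] := @irreducible_sub_closure _ _ V0 (emb @` supp u) s V0i.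
  - exact: V0V.
  - by move=> _ [x ux <-]; apply: scov; apply: sub_zariski_closure; exists x.
  apply: (subset_trans V0Y); apply: zariski_closureS => _ [[x ux <-] Yx].
  exists x => //; rewrite /supp /v /=.
  have [Yc Yi YV] := sP Y Ys.
  suff -> : `[< translate (emb 0) V0 (emb x) >] by [].
  apply/asboolP; rewrite /lattice_embed map_mx0; apply: V0max Yx => //.
  rewrite translate0; apply: subset_trans V0Y _.
  exact: zariski_closure_min Yc (@subIsetr _ _ _).
move=> j0 c0; apply: contrapT => nj.
have alone j : j != j0 -> c j != 0 -> ~ H (ev j - ev j0).
  by move=> jj0 cj Hj; apply: nj; exists j; split=> //; rewrite -lattice_embedB.
pose diffs := [seq emb (ev jk.1) - emb (ev jk.2) | jk <- enum {: J * J}].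
have [|psi [psiA psi_sep]] := @separating_form R d A [seq w <- diffs | ~~ (w <= A)%MS].
  by move=> w; rewrite mem_filter => /andP[].
pose phi e := psi (emb e).
have phiB : {morph phi : a b' / a - b'} by move=> a b'; rewrite /phi lattice_embedB raddfB.
pose phiM := GRing.isZmodMorphism.Build _ _ phi phiB.
pose phiA : {additive _ -> _} := HB.pack phi phiM.
apply: nvb; apply: (@mccoy _ _ _ negl negl0 neglD neglZ negl_shift H phiA _ HB J c ev _ B v j0 c0 alone).
- by move=> a /psiA.
- move=> j k /eqP; rewrite -subr_eq0 -raddfB /= => /eqP phi0; apply: contrapT => nH.
  have /psi_sep/eqP : emb (ev j) - emb (ev k) \in [seq w <- diffs | ~~ (w <= A)%MS].
    rewrite mem_filter -lattice_embedB; apply/andP; split; first exact/negP.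
    by rewrite lattice_embedB; apply/mapP; exists (j, k); rewrite // mem_enum.
  by rewrite -lattice_embedB; apply.
- split=> // [a b' /transH E|b']; first by apply/funext => x; rewrite /v E.
  suff -> : part c ev predT v b' = (fun=> 0) by [].
  apply/funext => x; rewrite /part /v.
  have E j : translate (emb (b' + ev j)) V0 (emb (x + ev j)) =
      translate (emb b') V0 (emb x).
    by rewrite /translate /= !lattice_embedD opprD addrACA subrr addr0.
  under eq_bigr do rewrite E; case: asboolP => _; first exact: ueq.
  by rewrite big1 // => j _; rewrite mulr0.
Qed.

End SupportClosure.

(** * The lower bounds *)

Section Relations.
Variables (F : numFieldType) (d : nat) (A : 'M[F]_d).
Implicit Types (i j k : 'I_d).

Let e i : 'rV[F]_d := delta_mx 0 i.

(** The sign accounts for the two exponents [e i] and [- e i] of each coordinate. *)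
Let linked i j := [exists s : bool, (e i - (-1) ^+ s *: e j <= A)%MS].

Let linked_refl i : linked i i.
Proof. by apply/existsP; exists false; rewrite scale1r subrr sub0mx. Qed.

Let linked_trans j i k : linked i j -> linked j k -> linked i k.
Proof.
move=> /existsP[s ij] /existsP[t jk]; apply/existsP; exists (s (+) t).
have := addmx_sub ij (scalemx_sub ((-1) ^+ s) jk).
by rewrite scalerBr addrA subrK scalerA signr_addb.
Qed.

Let linked_sym i j : linked i j -> linked j i.
Proof.
move=> /existsP[s ij]; apply/existsP; exists s.
have := scalemx_sub (- (-1) ^+ s) ij.
by rewrite scalerBr scalerA mulNr -expr2 sqrr_sign !scaleNr scale1r opprK addrC.
Qed.

Let linked_null i j : linked i j -> (e i <= A)%MS -> (e j <= A)%MS.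
Proof.
move=> /linked_sym/existsP[s ji] iA; rewrite -[e j](subrK ((-1) ^+ s *: e i)).
by rewrite addmx_sub // scalemx_sub.
Qed.

(** Modulo the row space, the coordinate vectors are spanned by one representative
    of each nonzero linkage class, and each of these classes has at least two
    elements. *)
Lemma rank_of_linked :
  (forall i, (e i <= A)%MS \/ exists2 j, j != i & linked i j) ->
  (d + #|[set i | (e i <= A)%MS]%SET| <= 2 * \rank A)%N.
Proof.
move=> Hlink; pose null := [set i | (e i <= A)%MS]%SET.
pose rep i := odflt i [pick j | linked i j].
have repP i : linked i (rep i).
  by rewrite /rep; case: pickP => //= /(_ i); rewrite linked_refl.
have rep_eq i j : linked i j -> rep i = rep j.
  move=> ij; rewrite /rep (eq_pick (Q := linked j)); last first.
    move=> k; apply/idP/idP; last exact: linked_trans.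
    exact/linked_trans/linked_sym.
  by case: pickP => // /(_ j); rewrite linked_refl.
pose S := rep @: ~: null.
have repS i : i \in S -> rep i = i.
  by move=> /imsetP[k _ ->]; rewrite -(rep_eq k).
have Snull i : i \in S -> i \notin null.
  move=> /imsetP[k kn ->]; move: kn; rewrite !inE; apply: contra => rA.
  exact: linked_null (linked_sym (repP k)) rA.
have rankS : (d <= \rank A + #|S|)%N.
  pose B := (\sum_(i in S) <<e i>>)%MS.
  have rB : (\rank B <= #|S|)%N.
    apply: leq_trans (mxrank_sum_leqif _) _; rewrite -sum1_card.
    by apply: leq_sum => i _; rewrite /= mxrank_gen mxrank_delta.
  apply: (@leq_trans (\rank (A + B)%MS)); last first.
    exact: leq_trans (mxrank_adds_leqif _ _) (leq_add _ _).
  rewrite -[X in (X <= _)%N](mxrank1 F d); apply: mxrankS; apply/row_subP => i.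
  rewrite row1 -/(e i).
  have [iA|niA] := boolP (e i <= A)%MS; first exact: submx_trans iA (addsmxSl _ _).
  have /existsP[s iS] := repP i.
  rewrite -[e i](subrK ((-1) ^+ s *: e (rep i))); apply: addmx_sub.
    exact: submx_trans iS (addsmxSl _ _).
  apply: scalemx_sub; apply: submx_trans (addsmxSr _ _).
  have rS : rep i \in S by apply: imset_f; rewrite !inE.
  by rewrite /B (bigD1 _ rS) /=; apply: submx_trans (addsmxSl _ _); rewrite genmxE.
(* Each representative of a class has a partner in its class which is not a
   representative. *)
pose mate i := odflt i [pick j | (j != i) && linked i j].
have mateP i : i \in S -> mate i != i /\ linked i (mate i).
  move=> /Snull; rewrite inE => niA; rewrite /mate; case: pickP => [j /andP[]//|nj] /=.
  by case: (Hlink i) => [iA|[j ji ij]]; [rewrite iA in niA | have := nj j; rewrite ji ij].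
have mate_inj : {in S &, injective mate}.
  move=> i j iS jS E; rewrite -(repS i iS) -(repS j jS); apply: rep_eq.
  have [_ im] := mateP i iS; have [_ /linked_sym jm] := mateP j jS.
  by apply: linked_trans im _; rewrite E.
have mateS i : i \in S -> mate i \notin S.
  move=> iS; have [mi im] := mateP i iS; apply: contra mi => /repS E.
  by rewrite -E -(rep_eq _ _ im) repS.
have mate_null i : i \in S -> mate i \notin null.
  move=> iS; have [mi im] := mateP i iS; have := Snull i iS; rewrite !inE.
  by apply: contra; apply/linked_null/linked_sym.
have : (#|S| + #|mate @: S| + #|null| <= d)%N.
  have SM : S :&: mate @: S = finset.set0.
    apply/setP => i; rewrite !inE; apply/negP => /andP[iS /imsetP[j jS E]].
    by case/negP: (mateS j jS); rewrite -E.
  have SMN : (S :|: mate @: S) :&: null = finset.set0.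
    apply/setP => i; rewrite finset.in_setI finset.in_setU finset.in_set0.
    apply/negP => /andP[/orP[/Snull/negP//|/imsetP[j jS ->]]].
    by apply/negP/mate_null.
  rewrite -(cardsUI S) SM cards0 addn0 -(cardsUI _ null) SMN cards0 addn0.
  by rewrite -[X in (_ <= X)%N]card_ord max_card.
by rewrite card_in_imset // -/null; move: rankS; lia.
Qed.

End Relations.

Section LowerBounds.
Variables (R : realType) (d : nat).
Local Notation C := R[i].
Implicit Types (lambda : C) (u : 'rV[int]_d -> C).

(** The extra unit for nonzero [lambda] comes from the exponent [0]: as it is not
    alone in its class, some coordinate vector is a direction. *)
Lemma eigenfunction_chain lambda u : nonzero u -> eigenfunction lambda u ->
  exists n, irreducible_chain (supp_closure u) n /\
    (d + (lambda != 0%R) <= 2 * n)%N.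
Proof.
move=> u0 ueig.
(* In homogeneous form the equation has the exponent [0] besides the signed
   coordinate vectors, with coefficient [- lambda]; it is a genuine exponent only
   when [lambda] is nonzero. *)
pose c (j : 'I_d * bool + unit) : C := if j is inl _ then 1 else - lambda.
pose ev (j : 'I_d * bool + unit) : 'rV[int]_d :=
  if j is inl (i, b) then (-1) ^+ b *: delta_mx 0 i else 0.
have [x|A [uA lone]] := @support_directions R d _ c ev u u0.
  rewrite big_sumType /= [X in _ + X](big_pred1 tt) => [|[]//].
  rewrite addr0 mulNr -ueig; apply/eqP; rewrite subr_eq0; apply/eqP.
  transitivity (\sum_i \sum_b u (x + ev (inl (i, b)))).
    by rewrite pair_bigA; apply: eq_bigr => -[i b] _; rewrite mul1r.
  apply: eq_bigr => i _; rewrite big_bool /=.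
  by rewrite expr0 expr1 scale1r scaleN1r addrC.
exists (\rank A); split=> //.
have evE i b : lattice_embed R (ev (inl (i, b))) = (-1) ^+ b *: delta_mx 0 i.
  apply/rowP => k; rewrite !mxE rmorphM rmorph_sign; congr (_ * _).
  by case: (_ && _).
have signK b (v : 'rV[C]_d) : ((-1) ^+ b *: v <= A)%MS -> (v <= A)%MS.
  by move=> /(scalemx_sub ((-1) ^+ b)); rewrite scalerA -expr2 sqrr_sign scale1r.
have ev0 : lattice_embed R (ev (inr tt)) = 0 by apply/rowP => k; rewrite !mxE.
apply: leq_trans (rank_of_linked (A := A) _).
  rewrite leq_add2l; have [//|l0] := eqVneq lambda 0; rewrite card_gt0.
  have [|x [xj _ xA]] := lone (inr tt); first by rewrite oppr_eq0.
  case: x xj xA => [[k b]|[]] // _.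
  rewrite evE ev0 subr0 => /signK kA.
  by apply/set0Pn; exists k; rewrite inE.
move=> i; have [|[[k b]|[]] [jj0 _]] := lone (inl (i, false)); first exact: oner_neq0.
  rewrite !evE scale1r => kA.
  have [ki|ki] := eqVneq k i; last first.
    right; exists k => //; apply/existsP; exists b.
    by have := scalemx_sub (-1) kA; rewrite scaleN1r opprB.
  left; rewrite ki in jj0 kA; case: b jj0 kA => [_|/eqP//].
  rewrite expr1 scaleN1r -opprD -mulr2n -scaler_nat -scaleN1r scalerA => kA.
  have := scalemx_sub (- 2%:R)^-1 kA.
  by rewrite scalerA mulN1r mulVf ?scale1r // oppr_eq0 pnatr_eq0.
rewrite evE ev0 sub0r scale1r => iA; left.
by have := scalemx_sub (-1) iA; rewrite scaleN1r opprK.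
Qed.

End LowerBounds.

(** * Eigenfunctions with small support *)

Section SmallSupport.
Variables (R : realType) (k m : nat).
Local Notation C := R[i].
Local Notation n := (k + m)%N.
Local Notation d := (k + n)%N.
Local Notation emb := (@lattice_embed R d).

(** The [d] coordinates come in [k] pairs [(fstc i, sndc i)] and [m] free ones. *)
Local Notation fstc i := (lshift n i).
Local Notation sndc i := (rshift k (lshift m i)).
Local Notation free j := (rshift k (rshift k j)).

Definition paired (K : nzRingType) (x : 'rV[K]_d) : bool :=
  [forall i : 'I_k, x ord0 (fstc i) == x ord0 (sndc i)].

Definition paired_basis (K : nzRingType) : 'M[K]_(n, d) :=
  row_mx (col_mx 1%:M 0) 1%:M.

Lemma paired_basisP (K : nzRingType) (y : 'rV[K]_n) : paired (y *m paired_basis K).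
Proof.
apply/forallP => i; rewrite mul_mx_row mulmx1 row_mxEl row_mxEr.
by rewrite -[y in X in X == _]hsubmxK mul_row_col mulmx0 addr0 mulmx1 mxE.
Qed.

Lemma pairedD (K : nzRingType) (x y : 'rV[K]_d) :
  paired y -> paired (x + y) = paired x.
Proof.
move=> /forallP yP; apply: eq_forallb => i; rewrite !mxE (eqP (yP i)).
by apply/eqP/eqP => [/addIr|->].
Qed.

Lemma paired_sub (v : 'rV[C]_d) : paired v = (v <= paired_basis C)%MS.
Proof.
apply/idP/idP => [/forallP vP|/submxP[y ->]]; last exact: paired_basisP.
apply/submxP; exists (rsubmx v); rewrite mul_mx_row mulmx1 -[LHS]hsubmxK.
congr row_mx; rewrite -[rsubmx v]hsubmxK mul_row_col mulmx0 addr0 mulmx1.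
by apply/rowP => i; rewrite !mxE; apply/eqP.
Qed.

Lemma rank_paired_basis : \rank (paired_basis C) = n.
Proof.
apply/eqP; apply/row_freeP; exists (col_mx 0 1%:M).
by rewrite mul_row_col mulmx0 add0r mulmx1.
Qed.

Lemma paired_embed (x : 'rV[int]_d) : paired (emb x) = paired x.
Proof. by apply: eq_forallb => i; rewrite !mxE eqr_int. Qed.

Lemma paired_basis_int j : row j (paired_basis C) = emb (row j (paired_basis int)).
Proof.
by rewrite /lattice_embed map_row map_row_mx map_col_mx !map_mx1 map_mx0.
Qed.

Variable w : 'I_m -> C.
Hypothesis w0 : forall j, w j != 0.

(** This character of the lattice takes the value [-1] on the first coordinate
    vector [e] of each pair and [1] on the second one [f]. Hence the function cut
    out by the pairing condition changes sign under [e + f], and its values at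
    [x + e] and [x - f] cancel for every [x], as do those at [x - e] and [x + f]. *)
Definition pair_character (x : 'rV[int]_d) : C :=
  (\prod_(i < k) (-1) ^ x ord0 (fstc i)) * \prod_(j < m) w j ^ x ord0 (free j).

Lemma pair_characterD x y :
  pair_character (x + y) = pair_character x * pair_character y.
Proof.
rewrite /pair_character mulrACA -!big_split /=.
by congr (_ * _); apply: eq_bigr => i _; rewrite mxE expfzDr // oppr_eq0 oner_eq0.
Qed.

Lemma pair_character_neq0 x : pair_character x != 0.
Proof.
apply: mulf_neq0; apply/prodf_neq0 => i _; apply: expfz_neq0 => //.
by rewrite oppr_eq0 oner_eq0.
Qed.

Definition paired_function (x : 'rV[int]_d) : C :=
  if paired x then pair_character x else 0.

Lemma paired_functionD x y :
  paired y -> paired_function (x + y) = pair_character y * paired_function x.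
Proof.
move=> yP; rewrite /paired_function pairedD // pair_characterD.
by case: ifP => _; rewrite ?mulr0 // mulrC.
Qed.

Lemma paired_function_neq0 x : (paired_function x != 0) = paired x.
Proof. by rewrite /paired_function; case: ifP => _; rewrite ?pair_character_neq0 ?eqxx. Qed.

Local Notation e i := (delta_mx 0 i : 'rV[int]_d).

Lemma paired_pair i : paired (e (fstc i) + e (sndc i)).
Proof. by apply/forallP => i'; rewrite !mxE /= !eq_shift addr0 add0r. Qed.

Lemma paired_free j : paired (e (free j)).
Proof. by apply/forallP => i'; rewrite !mxE /= !eq_shift. Qed.

Lemma pair_character_pair i : pair_character (e (fstc i) + e (sndc i)) = -1.
Proof.
rewrite /pair_character [X in _ * X]big1 ?mulr1 => [|j _]; last first.
  by rewrite !mxE /= !eq_shift addr0 expr0z.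
rewrite (bigD1 i) //= big1 ?mulr1 => [|i' /negPf i'i].
  by rewrite !mxE /= !eq_shift eqxx addr0 expr1z.
by rewrite !mxE /= !eq_shift i'i addr0 expr0z.
Qed.

Lemma pair_character_free j : pair_character (e (free j)) = w j.
Proof.
rewrite /pair_character big1 ?mul1r => [|i _]; last first.
  by rewrite !mxE /= !eq_shift expr0z.
rewrite (bigD1 j) //= big1 ?mulr1 => [|j' /negPf j'j].
  by rewrite !mxE /= !eq_shift eqxx expr1z.
by rewrite !mxE /= !eq_shift j'j expr0z.
Qed.

Lemma paired_function_eigen :
  eigenfunction (\sum_j (w j + (w j)^-1)) paired_function.
Proof.
move=> x; rewrite /adjacency !big_split_ord /= addrA -big_split /= big1 ?add0r => [|i _].
  rewrite mulr_suml; apply: eq_bigr => j _; rewrite mulrDl; congr (_ + _).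
    by rewrite paired_functionD ?paired_free // pair_character_free.
  rewrite -[in RHS](subrK (e (free j)) x) (paired_functionD (x - _)) ?paired_free //.
  by rewrite pair_character_free mulKf.
have pairE y : paired_function (y + e (fstc i)) = - paired_function (y - e (sndc i)).
  rewrite -mulN1r -(pair_character_pair i) -paired_functionD ?paired_pair //.
  by rewrite addrACA addNr addr0.
have pairE' y : paired_function (y + e (sndc i)) = - paired_function (y - e (fstc i)).
  rewrite -mulN1r -(pair_character_pair i) -paired_functionD ?paired_pair //.
  by rewrite addrA subrK.
by rewrite pairE pairE' addrACA; ring.
Qed.

(** The support is invariant under the lattice vectors of a basis of the linear
    space, so these are directions of its closure, and the closure contains [0]. *)
Lemma supp_closure_paired :
  supp_closure paired_function = affine_subspace 0 (paired_basis C).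
Proof.
set Y := supp_closure _; have Yc : zariski_closed Y by apply: zariski_closure_closed.
have Y0 : Y 0.
  apply: sub_zariski_closure; exists 0; last by rewrite /lattice_embed map_mx0.
  by rewrite /supp /= paired_function_neq0; apply/forallP => i; rewrite !mxE.
apply/seteqP; split.
  apply: zariski_closure_min; first exact: affine_subspace_closed.
  move=> _ [x ux <-]; rewrite /affine_subspace /= subr0 -paired_sub paired_embed.
  by rewrite -paired_function_neq0.
have [A AP] := direction_rowspace Y.
have BA : (paired_basis C <= A)%MS.
  apply/row_subP => j; apply/AP; rewrite paired_basis_int.
  apply: closed_direction => //; rewrite -zariski_closure_translate.
  apply: zariski_closureS => _ [x ux <-]; exists (x + row j (paired_basis int)).
    rewrite /supp /= paired_function_neq0 pairedD -?paired_function_neq0 //.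
    by rewrite paired_function_neq0 rowE paired_basisP.
  by rewrite lattice_embedD opprK.
move=> v; rewrite /affine_subspace /= subr0 => /submx_trans/(_ BA)/AP/(_ 0 1 Y0).
by rewrite add0r scale1r.
Qed.

Lemma paired_function_dim : has_dim (supp_closure paired_function) n.
Proof.
rewrite supp_closure_paired.
by have := has_dim_affine_subspace 0 (paired_basis C); rewrite rank_paired_basis.
Qed.

End SmallSupport.

Section Optimality.
Variable R : realType.
Local Notation C := R[i].

Lemma small_support_eigenfunction d k m (w : 'I_m -> C) :
  (d = k + (k + m))%N -> (forall j, w j != 0) ->
  exists u : 'rV[int]_d -> C, [/\ nonzero u,
    eigenfunction (\sum_j (w j + (w j)^-1)) u & has_dim (supp_closure u) (k + m)].
Proof.
move=> -> w0; exists (paired_function w); split.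
- exists 0; rewrite paired_function_neq0 //.
  by apply/forallP => i; rewrite !mxE.
- exact: paired_function_eigen.
- exact: paired_function_dim.
Qed.

(** A root of the monic quadratic polynomial ['X^2 - mu 'X + 1]. *)
Lemma add_inverse_surjective (mu : C) : exists2 z : C, z != 0 & z + z^-1 = mu.
Proof.
have [z zE] := @solve_monicpoly C 2 (fun i => if i is 0%N then -1 else mu) isT.
rewrite !big_ord_recl big_ord0 /= expr0 expr1 mulr1 addr0 in zE.
have z0 : z != 0.
  apply: contra_eq_neq zE => ->; rewrite mulr0 addr0 expr0n eq_sym oppr_eq0.
  exact: oner_neq0.
exists z => //; apply: (mulfI z0); rewrite mulrDr mulfV // -expr2 zE.
by rewrite addrAC addNr add0r mulrC.
Qed.

End Optimality.

Theorem theorem1p3 (R : realType) (d : nat) (hd : (2 <= d)%N) :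
  (forall (lambda : R[i]) (u : 'rV[int]_d -> R[i]),
      nonzero u -> eigenfunction lambda u ->
      dim_ge (supp_closure u) (uphalf d)) /\
  (forall (lambda : R[i]) (u : 'rV[int]_d -> R[i]),
      lambda != 0 -> nonzero u -> eigenfunction lambda u ->
      dim_ge (supp_closure u) (d./2).+1) /\
  (exists (lambda : R[i]) (u : 'rV[int]_d -> R[i]),
      [/\ nonzero u, eigenfunction lambda u
        & has_dim (supp_closure u) (uphalf d)]) /\
  (exists (lambda : R[i]) (u : 'rV[int]_d -> R[i]),
      [/\ lambda != 0, nonzero u, eigenfunction lambda u
        & has_dim (supp_closure u) (d./2).+1]) /\
  (exists u : 'rV[int]_d -> R[i],
      [/\ nonzero u, eigenfunction (2 * d)%:R u
        & has_dim (supp_closure u) (d./2).+1]).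
Proof.
have lower (lambda : R[i]) (u : 'rV[int]_d -> R[i]) k :
    (2 * k <= (d + (lambda != 0%R)).+1)%N -> nonzero u -> eigenfunction lambda u ->
    dim_ge (supp_closure u) k.
  move=> kd u0 /(eigenfunction_chain u0)[n [/dim_ge_chain[n' dimn nn'] dn]].
  by exists n' => //; lia.
have dE := odd_double_half d; have uE := uphalf_half d.
(* One free coordinate if [d] is odd, two if [d] is even; the second one then
   contributes [1 + 1^-1 = 2] to the eigenvalue. *)
have harmonic : exists u : 'rV[int]_d -> R[i],
    [/\ nonzero u, eigenfunction (2 * d)%:R u & has_dim (supp_closure u) (d./2).+1].
  case: (boolP (odd d)) => od; rewrite ?od ?(negPf od) in dE.
    have [z z0 zE] := add_inverse_surjective ((2 * d)%:R : R[i]).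
    have [||u] := @small_support_eigenfunction R d d./2 1 (fun=> z) => //; first by lia.
    by rewrite big_ord1 zE addn1 => uP; exists u.
  have [z z0 zE] := add_inverse_surjective ((2 * d)%:R - 2%:R : R[i]).
  have [||u] := @small_support_eigenfunction R d d./2.-1 2
      (fun i => if i == ord0 then z else 1).
  - by lia.
  - by move=> j; case: ifP => // _; apply: oner_neq0.
  rewrite !big_ord_recl big_ord0 /= addr0 invr1 zE subrK.
  by rewrite (_ : (d./2.-1 + 2 = d./2.+1)%N) => [uP|]; [exists u | lia].
split; [|split; [|split; [|split]]].
- by move=> lambda u; apply: lower; lia.
- by move=> lambda u l0; apply: lower; rewrite l0; lia.
- have [||u [u0 ueig udim]] := @small_support_eigenfunction R d d./2 (odd d) (fun=> 1).
  + by lia.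
  + by move=> _; apply: oner_neq0.
  by eexists; exists u; split; [exact: u0 | exact: ueig | rewrite uE addnC].
- have [u [u0 ueig udim]] := harmonic; exists (2 * d)%:R, u; split=> //.
  by rewrite pnatr_eq0; lia.
- exact: harmonic.
Qed.
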